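(* Let $n\ge1$ be an integer, let $f\in \bar{H}^{2,0}$, and let $\pi_n\in \mathcal{P}_n$ be a polynomial having no zero on $\mathbb{T}$. Put $P_{\pi_n}:=\{q_n\in \mathcal{P}_n:\ \|q_n/\pi_n\|_\infty=1\}$. Then $$d_2(f,\mathcal{R}_{n-1,n})=d_2(f,H^2_n)\ \geq\ \min_{q_n\in P_{\pi_n},\ p_{n-1}\in \mathcal{P}_{n-1}}\left\|\frac{q_nf-p_{n-1}}{\pi_n}\right\|_2 .$$
   Context: $\mathbb{D}$ is the open unit disk, $\mathbb{T}$ the unit circle, and $L^p=L^p(\mathbb{T})$ is taken with respect to normalized arclength $d\theta/2\pi$, with norm $\|\cdot\|_p$. $H^2$ is the Hardy space of $\mathbb{D}$, identified with the closed subspace of $L^2$ of functions whose Fourier coefficients of strictly negative index vanish. $\bar{H}^{2,0}$ is the closed subspace of $L^2$ of functions whose Fourier coefficients of non-negative index vanish. $\mathcal{P}_k$ is the space of complex polynomials of degree at most $k$. $\mathcal{R}_{m,n}$ is the set of rational functions $p/q$ with $p\in\mathcal{P}_m$, $q\in\mathcal{P}_n$, $q$ having no root on $\mathbb{T}$. $B_n$ is the set of Blaschke products of degree at most $n$ (unimodular constants included), and $H_n^2:=\{g/b:\ g\in H^2,\ b\in B_n\}\subset L^2$. $d_2(f,E)$ is the distance from $f$ to $E$ in $L^2$. (The expression $(q_nf-p_{n-1})/\pi_n$ is the linearized error with weight $1/\pi_n$.) *)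

(* Defs.v *)
From HB Require Import structures.
From mathcomp Require Import all_boot all_order all_algebra.
From mathcomp Require Import complex.
From mathcomp Require Import all_classical all_reals all_analysis.

Set Implicit Arguments.
Unset Strict Implicit.
Unset Printing Implicit Defensive.

Import Order.TTheory GRing.Theory Num.Theory.
Import ComplexField.Normc.

Local Open Scope classical_set_scope.
Local Open Scope ring_scope.
Local Open Scope complex_scope.

(* Functions on the unit circle are represented by total functions
   R[i] -> R[i]; only their values on the circle matter, since every notion of
   measurability, integral, norm and distance below goes through the
   parametrization [circ]. An element of L^2 is handled through its
   representatives, not as a class modulo equality almost everywhere. *)

Section Circle.
Context {R : realType}.
Implicit Types (f g : R[i] -> R[i]) (p q : {poly R[i]}) (E : set (R[i] -> R[i])).

Definition circ (t : R) : R[i] := cos t +i* sin t.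

Definition on_circle (z : R[i]) : Prop := normc z = 1.

Lemma twopi_gt0 : 0 < pi *+ 2 :> R.
Proof. by rewrite mulrn_wgt0 // pi_gt0. Qed.

(* dt / 2pi on [0, 2pi] *)
Definition arclength : probability (measurableTypeR R) R := uniform_prob twopi_gt0.

(* The moduli are taken in R: the library's `|z| lives in R[i]. *)
Definition Lpnorm (r : \bar R) f : \bar R :=
  ('N[arclength]_r[(fun t => (normc (f (circ t)))%:E)])%E.

Definition L2 : set (R[i] -> R[i]) := [set f |
  [/\ measurable_fun [set: R] (fun t => complex.Re (f (circ t))),
      measurable_fun [set: R] (fun t => complex.Im (f (circ t))) &
      (Lpnorm 2%:E f < +oo)%E]].

Definition circle_integral f : R[i] :=
  (\int[arclength]_t complex.Re (f (circ t)))
  +i* (\int[arclength]_t complex.Im (f (circ t))).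

(* On the circle z ^ (- k) = e^{-ikt}. *)
Definition fourier f (k : int) : R[i] :=
  circle_integral (fun z => f z * z ^ (- k)).

Definition H2 : set (R[i] -> R[i]) :=
  [set f | L2 f /\ forall k : int, k < 0 -> fourier f k = 0].

Definition H2bar0 : set (R[i] -> R[i]) :=
  [set f | L2 f /\ forall k : int, 0 <= k -> fourier f k = 0].

Definition poly_le (k : nat) : set {poly R[i]} := [set p | (size p <= k.+1)%N].

Definition no_zero_on_circle q : Prop := forall z, on_circle z -> ~~ root q z.

Definition ratfun (m n : nat) : set (R[i] -> R[i]) := [set h |
  exists p q, [/\ poly_le m p, poly_le n q, no_zero_on_circle q &
                  h = fun z => p.[z] / q.[z]]].

Definition blaschke_product (c : R[i]) (s : seq R[i]) (z : R[i]) : R[i] :=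
  c * \prod_(a <- s) ((z - a) / (1 - a^* * z)).

Definition blaschke (n : nat) : set (R[i] -> R[i]) := [set b |
  exists c s, [/\ normc c = 1, (size s <= n)%N,
                  {in s, forall a, normc a < 1} & b = blaschke_product c s]].

Definition H2n (n : nat) : set (R[i] -> R[i]) := [set h |
  exists g b, [/\ H2 g, blaschke n b & h = fun z => g z / b z]].

Definition d2 f E : \bar R :=
  ereal_inf [set Lpnorm 2%:E (fun z => f z - g z) | g in E].

Definition normalized_polys (n : nat) (w : {poly R[i]}) : set {poly R[i]} :=
  [set q | poly_le n q /\ Lpnorm +oo%E (fun z => q.[z] / w.[z]) = 1%E].

Definition is_min (S : set (\bar R)) (m : \bar R) : Prop := S m /\ lbound S m.

End Circle.

(* Main.v *)
Require Import Defs.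
From mathcomp Require Import all_boot all_order all_algebra.
From mathcomp Require Import complex.
From mathcomp Require Import all_classical all_reals all_analysis.
From mathcomp Require Import measurable_realfun ess_sup_inf ring lra.

(** The distance to the rational functions equals the distance to [H2n] for the
    following reason. A rational function without poles on the circle is, on the circle,
    a quotient [g / b] with [g] in [H2] and [b] the Blaschke product of the roots of its
    denominator in the disk ([ratfun_H2n]). Conversely let [h = g / b] be in [H2n], where
    [b] has at most [n] zeros. As [b] is unimodular on the circle, the error [f - h] has
    the norm of [b f - g]. For [f] in [H2bar0] one has [b f = v + r] with [v] in [H2bar0]
    and [r] analytic and rational ([H2bar0_blaschke]), so the orthogonality of [H2bar0]
    and [H2] shows that [r / b], which is a rational function of type [(n - 1, n)], is at
    least as good an approximant as [h] ([H2n_ratfun]).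

    Orthogonality of [H2bar0] and [H2] ([H2bar0_orth_H2]) is where analysis enters: the
    two spaces are defined by the vanishing of Fourier coefficients, and to pair two of
    their elements one has to know that trigonometric polynomials are dense in L^2
    ([trig_dense_csqint]). For this, the measurable sets whose indicator is an L^1 limit
    of trigonometric polynomials with values in [[0, 1]] are seen to form a sigma-algebra
    containing the arcs ([trig_approx_measurable]); one concludes with simple functions.

    For the inequality, a rational function [p / q] may be rescaled so that the supremum
    norm of [q / w] is 1. Then the linearized error [(q f - p) / w] is the error
    [f - p / q] multiplied by a function bounded by 1 ([linearized_le_error]), so its norm
    is not larger. The minimum is attained ([linearized_min]) because in real coordinates
    the supremum norm of [q / w] and the L^2 norm of the linearized error are seminorms
    whose sum is coercive: the coefficients of a polynomial are Fourier coefficients,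
    hence bounded by norms on the circle ([linearized_coercive], [seminorm_min]). *)

Set Implicit Arguments.
Unset Strict Implicit.
Unset Printing Implicit Defensive.

Import Order.TTheory GRing.Theory Num.Theory.
Import numFieldNormedType.Exports.
Import ComplexField.Normc.
Import HBNNSimple.

Local Open Scope classical_set_scope.
Local Open Scope ring_scope.
Local Open Scope complex_scope.

Local Notation Re := complex.Re.
Local Notation Im := complex.Im.

(** * Square-integrable real functions of the angle *)

Section SquareIntegrable.
Context {R : realType}.
Local Notation mu := (@arclength R).
Implicit Types (r s : R -> R).

Lemma arclength_integrable_cst (k : R) : mu.-integrable setT (EFin \o cst k).
Proof. exact: finite_measure_integrable_cst. Qed.

Lemma integrable_EFinD r s : mu.-integrable setT (EFin \o r) ->
  mu.-integrable setT (EFin \o s) ->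
  mu.-integrable setT (EFin \o (fun t => r t + s t)).
Proof.
move=> ir is_; rewrite (_ : _ \o _ = (EFin \o r) \+ (EFin \o s))%E; last exact/funext.
exact: integrableD.
Qed.

Lemma integrable_EFinZ k r : mu.-integrable setT (EFin \o r) ->
  mu.-integrable setT (EFin \o (fun t => k * r t)).
Proof.
move=> ir; rewrite (_ : _ \o _ = fun t => (k%:E * (EFin \o r) t)%E); last exact/funext.
exact: integrableZl.
Qed.

(** Lets [filterS] apply to statements holding almost everywhere for [arclength]. *)
#[export] Instance arclength_ae_filter : Filter (nbhs (almost_everywhere mu)).
Proof. exact: (ae_filter_ringOfSetsType mu). Qed.

Definition sqint r := measurable_fun [set: R] r /\
  mu.-integrable setT (EFin \o (fun t => r t ^+ 2)).

Lemma integrable_le r s : measurable_fun [set: R] r ->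
  (forall t, `|r t| <= s t) -> mu.-integrable setT (EFin \o s) ->
  mu.-integrable setT (EFin \o r).
Proof.
move=> mr rs; apply: le_integrable => //; first exact/measurable_EFinP.
by move=> t _ /=; rewrite lee_fin (le_trans (rs t))// ler_norm.
Qed.

Lemma sqintM r s : sqint r -> sqint s -> mu.-integrable setT (EFin \o (fun t => r t * s t)).
Proof.
move=> [mr ir] [ms is_]; apply: (integrable_le (s := fun t => r t ^+ 2 + s t ^+ 2)).
- exact: measurable_funM.
- move=> t; rewrite ler_norml; apply/andP; split; nra.
- exact: integrable_EFinD.
Qed.

Lemma sqint_bndM r s (C : R) : measurable_fun [set: R] r -> (forall t, `|r t| <= C) ->
  sqint s -> sqint (fun t => r t * s t).
Proof.
move=> mr rC [ms is_]; split; first exact: measurable_funM.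
apply: (integrable_le (s := fun t => C ^+ 2 * s t ^+ 2)).
- exact/measurable_funX/measurable_funM.
- move=> t; rewrite ger0_norm ?sqr_ge0// exprMn ler_wpM2r ?sqr_ge0//.
  by rewrite -[leLHS]real_normK ?num_real// ler_sqr ?nnegrE ?rC// (le_trans _ (rC t)).
- exact: integrable_EFinZ.
Qed.

Lemma sqintD r s : sqint r -> sqint s -> sqint (fun t => r t + s t).
Proof.
move=> [mr ir] [ms is_]; split; first exact: measurable_funD.
apply: (integrable_le (s := fun t => (r t ^+ 2 + s t ^+ 2) + (r t ^+ 2 + s t ^+ 2))).
- exact/measurable_funX/measurable_funD.
- move=> t; rewrite ger0_norm ?sqr_ge0//; have := sqr_ge0 (r t - s t); nra.
- by apply: integrable_EFinD => //; exact: integrable_EFinD.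
Qed.

Lemma sqint_cst (k : R) : sqint (fun=> k).
Proof.
split; first exact: measurable_cst.
exact: arclength_integrable_cst.
Qed.

Lemma sqint_bnd r (C : R) : measurable_fun [set: R] r -> (forall t, `|r t| <= C) ->
  sqint r.
Proof.
move=> mr rC; have := sqint_bndM mr rC (sqint_cst 1).
by under eq_fun do rewrite mulr1.
Qed.

Lemma sqintZ k r : sqint r -> sqint (fun t => k * r t).
Proof. by move=> sr; apply: (@sqint_bndM (cst k) r `|k|) => // t. Qed.

Lemma sqintN r : sqint r -> sqint (fun t => - r t).
Proof. by move/(sqintZ (-1)); under eq_fun do rewrite mulN1r. Qed.

Lemma sqintB r s : sqint r -> sqint s -> sqint (fun t => r t - s t).
Proof. by move=> sr /sqintN; exact: sqintD. Qed.

Lemma sqint_integrable r : sqint r -> mu.-integrable setT (EFin \o r).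
Proof.
move=> sr; have := sqintM sr (sqint_cst 1).
by under [in X in X -> _]eq_fun do rewrite mulr1.
Qed.

End SquareIntegrable.

(** * Real and imaginary parts *)

Section RealParts.
Context {R : realType}.
Implicit Types x y z : R[i].

Lemma cReM x y : Re (x * y) = Re x * Re y - Im x * Im y.
Proof. by case: x => a b; case: y. Qed.

Lemma cImM x y : Im (x * y) = Re x * Im y + Im x * Re y.
Proof. by case: x => a b; case: y. Qed.

Lemma cReD x y : Re (x + y) = Re x + Re y.
Proof. by case: x => a b; case: y. Qed.

Lemma cImD x y : Im (x + y) = Im x + Im y.
Proof. by case: x => a b; case: y. Qed.

Lemma normc_sqr x : normc x ^+ 2 = Re x ^+ 2 + Im x ^+ 2.
Proof. by case: x => a b /=; rewrite sqr_sqrtr// addr_ge0// sqr_ge0. Qed.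

Lemma normc_ge0 x : 0 <= normc x.
Proof. by case: x => a b /=; exact: sqrtr_ge0. Qed.

Lemma normRe_le x : `|Re x| <= normc x.
Proof.
rewrite -ler_sqr ?nnegrE ?normc_ge0//= normc_sqr.
by rewrite real_normK ?num_real// lerDl sqr_ge0.
Qed.

Lemma normIm_le x : `|Im x| <= normc x.
Proof.
rewrite -ler_sqr ?nnegrE ?normc_ge0//= normc_sqr.
by rewrite real_normK ?num_real// lerDr sqr_ge0.
Qed.

Lemma cnormN x : normc (- x) = normc x.
Proof. by case: x => a b /=; rewrite !sqrrN. Qed.

Lemma normc_eq0 x : (normc x == 0) = (x == 0).
Proof. by apply/eqP/eqP => [/eq0_normc//|->]; rewrite normc0. Qed.

Lemma normc_le_ReIm x : normc x <= `|Re x| + `|Im x|.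
Proof.
have a0 : 0 <= `|Re x| by []. have b0 : 0 <= `|Im x| by [].
rewrite -ler_sqr ?nnegrE ?normc_ge0 ?addr_ge0// normc_sqr.
rewrite -[X in X + _]real_normK ?num_real// -[X in _ + X]real_normK ?num_real//.
nra.
Qed.

End RealParts.

(** * The real inner product of complex square-integrable functions *)

Section ComplexL2.
Context {R : realType}.
Local Notation mu := (@arclength R).
Implicit Types (u v w : R -> R[i]).

Definition csqint u := sqint (fun t => Re (u t)) /\ sqint (fun t => Im (u t)).

(** These functions act on square-integrable ones by multiplication. *)
Definition bounded_mfun u := [/\ measurable_fun [set: R] (fun t => Re (u t)),
  measurable_fun [set: R] (fun t => Im (u t)) &
  exists C, forall t, normc (u t) <= C].

Lemma bounded_csqint u : bounded_mfun u -> csqint u.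
Proof.
move=> [mr mi [C uC]]; split; apply: (sqint_bnd (C := C)) => // t.
  exact: le_trans (normRe_le _) (uC t).
exact: le_trans (normIm_le _) (uC t).
Qed.

Lemma bounded_mfun_cst (c : R[i]) : bounded_mfun (fun=> c).
Proof.
by split; [exact: measurable_cst|exact: measurable_cst|exists (normc c)].
Qed.

Lemma bounded_mfunD u v : bounded_mfun u -> bounded_mfun v ->
  bounded_mfun (fun t => u t + v t).
Proof.
move=> [mru miu [C uC]] [mrv miv [D vD]]; split.
- by under eq_fun do rewrite cReD; exact: measurable_funD.
- by under eq_fun do rewrite cImD; exact: measurable_funD.
- by exists (C + D) => t; exact: le_trans (le_normcD _ _) (lerD (uC t) (vD t)).
Qed.

Lemma bounded_mfunM u v : bounded_mfun u -> bounded_mfun v ->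
  bounded_mfun (fun t => u t * v t).
Proof.
move=> [mru miu [C uC]] [mrv miv [D vD]]; split.
- by under eq_fun do rewrite cReM; apply: measurable_funB; exact: measurable_funM.
- by under eq_fun do rewrite cImM; apply: measurable_funD; exact: measurable_funM.
- by exists (C * D) => t; rewrite normcM ler_pM// normc_ge0.
Qed.

Lemma csqintD u v : csqint u -> csqint v -> csqint (fun t => u t + v t).
Proof.
move=> [ru iu] [rv iv]; split.
- by under eq_fun do rewrite cReD; exact: sqintD.
- by under eq_fun do rewrite cImD; exact: sqintD.
Qed.

Lemma csqint_bndM u v : bounded_mfun u -> csqint v -> csqint (fun t => u t * v t).
Proof.
move=> [mru miu [C uC]] [rv iv].
have uR t : `|Re (u t)| <= C by exact: le_trans (normRe_le _) (uC t).
have uI t : `|Im (u t)| <= C by exact: le_trans (normIm_le _) (uC t).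
split.
- by under eq_fun do rewrite cReM; apply: sqintB; apply: sqint_bndM; eauto.
- by under eq_fun do rewrite cImM; apply: sqintD; apply: sqint_bndM; eauto.
Qed.

Lemma csqintZ (c : R[i]) u : csqint u -> csqint (fun t => c * u t).
Proof. by apply: csqint_bndM; exact: bounded_mfun_cst. Qed.

Lemma csqintB u v : csqint u -> csqint v -> csqint (fun t => u t - v t).
Proof.
move=> su /(csqintZ (-1)); under eq_fun do rewrite mulN1r.
exact: csqintD.
Qed.

(** The real part of the Hermitian product. Nothing is lost by dropping the
    imaginary part, since the second argument can be multiplied by a scalar. *)
Definition dot u v := \int[mu]_t (Re (u t) * Re (v t) + Im (u t) * Im (v t)).

Lemma dot_int u v : csqint u -> csqint v ->
  mu.-integrable setT (EFin \o (fun t => Re (u t) * Re (v t) + Im (u t) * Im (v t))).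
Proof. by move=> [ru iu] [rv iv]; apply: integrable_EFinD; exact: sqintM. Qed.

Lemma dotC u v : dot u v = dot v u.
Proof.
by rewrite /dot; congr Rintegral; apply/funext => t; rewrite mulrC (mulrC (Im _)).
Qed.

Lemma dotDl u v w : csqint u -> csqint v -> csqint w ->
  dot (fun t => u t + v t) w = dot u w + dot v w.
Proof.
move=> su sv sw; rewrite /dot -RintegralD//; [|exact: dot_int..].
by congr Rintegral; apply/funext => t; rewrite cReD cImD; ring.
Qed.

Lemma dotZl (k : R) u v : csqint u -> csqint v ->
  dot (fun t => k%:C * u t) v = k * dot u v.
Proof.
move=> su sv; rewrite /dot -RintegralZl//; last exact: dot_int.
by congr Rintegral; apply/funext => t; rewrite cReM cImM /=; ring.
Qed.

Lemma dotBl u v w : csqint u -> csqint v -> csqint w ->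
  dot (fun t => u t - v t) w = dot u w - dot v w.
Proof.
move=> su sv sw.
rewrite (_ : (fun t => _) = fun t => u t + (-1)%:C * v t).
  by rewrite dotDl ?dotZl ?mulN1r//; exact: csqintZ.
by apply/funext => t; rewrite rmorphN1 mulN1r.
Qed.

Lemma dotDr u v w : csqint u -> csqint v -> csqint w ->
  dot u (fun t => v t + w t) = dot u v + dot u w.
Proof. by move=> *; rewrite dotC dotDl// (dotC v) (dotC w). Qed.

Lemma dotBr u v w : csqint u -> csqint v -> csqint w ->
  dot u (fun t => v t - w t) = dot u v - dot u w.
Proof. by move=> *; rewrite dotC dotBl// (dotC v) (dotC w). Qed.

Lemma dotZr (k : R) u v : csqint u -> csqint v ->
  dot u (fun t => k%:C * v t) = k * dot u v.
Proof. by move=> *; rewrite dotC dotZl// dotC. Qed.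

Lemma dot_ge0 u : 0 <= dot u u.
Proof.
by apply: Rintegral_ge0 => t _; rewrite -!expr2 addr_ge0// sqr_ge0.
Qed.

Lemma dotuu u : dot u u = \int[mu]_t (normc (u t) ^+ 2).
Proof. by rewrite /dot; congr Rintegral; apply/funext => t; rewrite normc_sqr !expr2. Qed.

(** The square norm of [s u - t v] is nonnegative; take [s = dot v v] and
    [t = dot u v]. *)
Lemma cauchy_schwarz u v : csqint u -> csqint v ->
  dot u v ^+ 2 <= dot u u * dot v v.
Proof.
move=> su sv.
have H (s t : R) : 0 <= s ^+ 2 * dot u u - 2 * s * t * dot u v + t ^+ 2 * dot v v.
  have := dot_ge0 (fun x => s%:C * u x - t%:C * v x).
  have su' := csqintZ s%:C su; have sv' := csqintZ t%:C sv.
  rewrite dotBl ?dotBr ?dotZl ?dotZr//; last exact: csqintB.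
  by rewrite (dotC v u); nra.
have [v0|v0] := eqVneq (dot v v) 0.
  have [->|d0] := eqVneq (dot u v) 0; first by rewrite v0; nra.
  (* here the quadratic form is affine in [t], so it becomes negative for a suitable [t] *)
  have := H 1 ((dot u u + 1) / dot u v / 2); rewrite v0.
  have -> : 2 * 1 * ((dot u u + 1) / dot u v / 2) * dot u v = dot u u + 1 by field.
  lra.
have vp : 0 < dot v v by rewrite lt_neqAle eq_sym v0 dot_ge0.
have := H (dot v v) (dot u v).
nra.
Qed.

Definition l2norm u := Num.sqrt (dot u u).

Lemma l2norm_ge0 u : 0 <= l2norm u.
Proof. exact: sqrtr_ge0. Qed.

Lemma l2norm_sqr u : l2norm u ^+ 2 = dot u u.
Proof. by rewrite sqr_sqrtr// dot_ge0. Qed.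

Lemma normr_dot_le u v : csqint u -> csqint v -> `|dot u v| <= l2norm u * l2norm v.
Proof.
move=> su sv; rewrite -ler_sqr ?nnegrE ?mulr_ge0 ?l2norm_ge0//.
by rewrite real_normK ?num_real// exprMn !l2norm_sqr cauchy_schwarz.
Qed.

Lemma l2normD u v : csqint u -> csqint v -> l2norm (fun t => u t + v t) <= l2norm u + l2norm v.
Proof.
move=> su sv; rewrite -ler_sqr ?nnegrE ?addr_ge0 ?l2norm_ge0//.
rewrite l2norm_sqr sqrrD !l2norm_sqr dotDl ?dotDr//; last exact: csqintD.
rewrite (dotC v u).
have := le_trans (ler_norm _) (normr_dot_le su sv); lra.
Qed.

Lemma l2norm_eq_norm u v : (forall t, normc (u t) = normc (v t)) -> l2norm u = l2norm v.
Proof.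
move=> uv; rewrite /l2norm !dotuu; congr (Num.sqrt (Rintegral _ _ _)).
by apply/funext => t; rewrite uv.
Qed.

Lemma l2normZ (c : R[i]) u : csqint u -> l2norm (fun t => c * u t) = normc c * l2norm u.
Proof.
move=> su; rewrite (@l2norm_eq_norm _ (fun t => (normc c)%:C * u t)); last first.
  by move=> t; rewrite !normcM /= expr0n /= addr0 sqrtr_sqr ger0_norm ?normc_ge0.
rewrite /l2norm dotZl ?dotZr//; last exact: csqintZ.
by rewrite mulrA -expr2 sqrtrM ?sqr_ge0// sqrtr_sqr ger0_norm// normc_ge0.
Qed.

Lemma l2norm_int u : csqint u ->
  mu.-integrable setT (EFin \o (fun t => normc (u t) ^+ 2)).
Proof.
move=> su; have := dot_int su su; congr (_.-integrable _ (_ \o _)).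
by apply/funext => t; rewrite normc_sqr !expr2.
Qed.

End ComplexL2.

(** * Powers, polynomials and rational functions on the circle *)

Section CircleFunctions.
Context {R : realType}.
Local Notation mu := (@arclength R).
Implicit Types (u v : R -> R[i]) (f g : R[i] -> R[i]).

Lemma normc_circ t : normc (circ t : R[i]) = 1.
Proof. by rewrite /circ /= cos2Dsin2 sqrtr1. Qed.

Lemma circ_neq0 t : (circ t : R[i]) != 0.
Proof. by rewrite -normc_eq0 normc_circ oner_eq0. Qed.

Lemma circX t m : (circ t : R[i]) ^+ m = circ (m%:R * t).
Proof.
elim: m => [|m IH]; first by rewrite expr0 /circ mul0r cos0 sin0.
rewrite exprS IH -natr1 mulrDl mul1r /circ cosD sinD.
by apply/eqP; rewrite eq_complex cReM cImM /=; apply/andP; split; apply/eqP; ring.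
Qed.

Lemma bounded_mfun_circ : bounded_mfun (circ : R -> R[i]).
Proof.
split; [| |by exists 1 => t; rewrite normc_circ].
- apply: continuous_measurable_fun; exact: continuous_cos.
- apply: continuous_measurable_fun; exact: continuous_sin.
Qed.

Lemma invc_ReIm (x : R[i]) :
  x^-1 = (Re x / (Re x ^+ 2 + Im x ^+ 2)) -i* (Im x / (Re x ^+ 2 + Im x ^+ 2)).
Proof. by case: x. Qed.

Lemma bounded_mfunV u (d : R) : 0 < d -> (forall t, d <= normc (u t)) ->
  bounded_mfun u -> bounded_mfun (fun t => (u t)^-1).
Proof.
move=> d0 ud [mr mi _].
have mV : measurable_fun [set: R] (fun t => (Re (u t) ^+ 2 + Im (u t) ^+ 2)^-1).
  (* the real inverse as a power, whose measurability in the base is known *)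
  under eq_fun do rewrite -powR_inv1 ?addr_ge0 ?sqr_ge0//.
  apply: (measurableT_comp (measurable_powR _)).
  by apply: measurable_funD; exact: measurable_funX.
split.
- by under eq_fun do rewrite invc_ReIm /=; exact: measurable_funM.
- under eq_fun do rewrite invc_ReIm /=.
  by apply: measurable_funN; exact: measurable_funM.
- exists d^-1 => t; rewrite normcV lef_pV2 ?posrE//.
  exact: lt_le_trans (ud t).
Qed.

(** A point off the circle stays at distance at least [|1 - |b||] from it. *)
Lemma bounded_mfun_subV (b : R[i]) : normc b != 1 ->
  bounded_mfun (fun t => (circ t - b)^-1).
Proof.
move=> b1; apply: (@bounded_mfunV _ `|1 - normc b|).
- by rewrite normr_gt0 subr_eq0 eq_sym.
- move=> t; have := le_normcD (circ t - b) b; rewrite subrK normc_circ => h1.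
  have := le_normcD (b - circ t) (circ t); rewrite subrK normc_circ => h2.
  rewrite -opprB cnormN in h2.
  by rewrite ler_norml; apply/andP; split; lra.
- apply: bounded_mfunD; first exact: bounded_mfun_circ.
  exact: bounded_mfun_cst.
Qed.

Lemma bounded_mfun_horner (p : {poly R[i]}) : bounded_mfun (fun t => p.[circ t]).
Proof.
elim/poly_ind: p => [|p c IH].
  by under eq_fun do rewrite horner0; exact: bounded_mfun_cst.
under eq_fun do rewrite hornerMXaddC.
apply: bounded_mfunD; last exact: bounded_mfun_cst.
by apply: bounded_mfunM => //; exact: bounded_mfun_circ.
Qed.

(** The field is algebraically closed, so the inverse is a product of inverses of
    degree one factors with roots off the circle. *)
Lemma bounded_mfun_hornerV (p : {poly R[i]}) : no_zero_on_circle p ->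
  bounded_mfun (fun t => p.[circ t]^-1).
Proof.
move=> p1; have [rs def_p] := closed_field_poly_normal p.
have rs1 : {in rs, forall r, normc r != 1}.
  move=> r rrs; apply/eqP => /p1/negP; apply.
  have [->|p0] := eqVneq p 0; first exact: root0.
  by rewrite def_p rootZ ?lead_coef_eq0// root_prod_XsubC.
rewrite def_p {def_p}; elim: rs rs1 => [|r rs IH] rs1.
  under eq_fun do rewrite big_nil hornerZ hornerC.
  exact: bounded_mfun_cst.
under eq_fun do rewrite big_cons hornerZ hornerM mulrCA -hornerZ hornerXsubC invfM.
apply: bounded_mfunM.
  by apply: bounded_mfun_subV; apply: rs1; rewrite mem_head.
by apply: IH => s srs; apply: rs1; rewrite inE srs orbT.
Qed.

Lemma circXz t (k : int) : (circ t : R[i]) ^ k = circ (k%:~R * t).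
Proof.
case: k => m; first exact: circX.
rewrite NegzE -exprz_inv.
have -> : (circ t)^-1 = circ (- t) :> R[i].
  apply: (mulfI (circ_neq0 t)); rewrite divff ?circ_neq0//.
  apply/eqP; rewrite eq_complex cReM cImM /= cosN sinN.
  by rewrite mulrN opprK -!expr2 cos2Dsin2 mulrN mulrC addNr !eqxx.
by rewrite (_ : _ ^ _ = circ (- t) ^+ m.+1)// circX rmorphN mulrN mulNr.
Qed.

Lemma bounded_mfun_circXz (k : int) : bounded_mfun (fun t => (circ t : R[i]) ^ k).
Proof.
split; [under eq_fun do rewrite circXz..|exists 1 => t; by rewrite circXz normc_circ].
- apply: continuous_measurable_fun => x; apply: continuous_comp.
    by apply: continuousM => //; exact: cvg_cst.
  exact: continuous_cos.
- apply: continuous_measurable_fun => x; apply: continuous_comp.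
    by apply: continuousM => //; exact: cvg_cst.
  exact: continuous_sin.
Qed.

(** Nonnegativity allows the passage to the density of the uniform law; a bounded
    integrand is reduced to this case by adding a constant. *)
Lemma Rintegral_arclength_ftc (r F : R -> R) : (forall t, 0 <= r t) ->
  continuous r -> (forall t : R, is_derive t 1 F (r t)) ->
  \int[mu]_t r t = (pi *+ 2)^-1 * (F (pi *+ 2) - F 0).
Proof.
move=> r0 cr dF; have cF x : {for x, continuous F}.
  by apply: differentiable_continuous; apply/derivable1_diffP; have [] := dF x.
have ftc : (\int[lebesgue_measure]_(x in `[0%R, (pi *+ 2)%R]) (r x)%:E =
    (F (pi *+ 2))%:E - (F 0)%:E)%E.
  apply: continuous_FTC2.
  - exact: twopi_gt0.
  - exact: continuous_subspaceT.
  - split.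
    + by move=> x _; have [] := dF x.
    + by apply: cvg_at_right_filter; exact: cF.
    + by apply: cvg_at_left_filter; exact: cF.
  - by move=> x _; rewrite derive1E; apply: derive_val.
rewrite /Rintegral /arclength integral_uniform; first by rewrite ftc subr0.
- by apply/measurable_EFinP; exact: continuous_measurable_fun.
- by move=> t; rewrite lee_fin.
Qed.

(** A primitive of [1 + cos (k t)] is [t + sin (k t) / k], and its periodic part does
    not contribute to the mean; likewise for the sine. *)
Lemma Rintegral_cos_sin (k : int) : k != 0 ->
  \int[mu]_t cos (k%:~R * t) = 0 /\ \int[mu]_t sin (k%:~R * t) = 0.
Proof.
move=> k0; have kR0 : (k%:~R : R) != 0 by rewrite intr_eq0.
have bk := bounded_mfun_circXz k.
have [] := bounded_csqint bk.
under [X in sqint X -> _]eq_fun do rewrite circXz /=.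
under [X in _ -> sqint X -> _]eq_fun do rewrite circXz /=.
move=> sc ss.
have pi0 : (pi *+ 2 : R) != 0 by rewrite gt_eqF// twopi_gt0.
have c1 : \int[mu]_t (1 : R) = 1.
  rewrite Rintegral_cst// mul1r.
  by rewrite [X in fine X](_ : _ = 1%E)//; exact: probability_setT.
have km (x : R) : is_derive x 1 (fun t : R => k%:~R * t) k%:~R.
  by apply: is_derive_eq; rewrite /GRing.scale/= mulr1 ?mulr0 ?addr0.
have ends (f : R -> R) : periodic f (pi *+ 2) -> f (k%:~R * (pi *+ 2)) = f 0.
  move=> pf; case: (k) => m.
    by rewrite mulr_natl -[in RHS](periodicn pf m) add0r.
  rewrite NegzE rmorphN mulNr mulr_natl -(periodicn pf m.+1) addNr//.
have dsin (t : R) : is_derive t 1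
    (fun t => t + k%:~R^-1 * sin (k%:~R * t)) (1 + cos (k%:~R * t)).
  have d1 := is_derive1_comp (is_derive_sin (k%:~R * t)) (km t).
  have d2 := @is_deriveZ _ _ _ _ k%:~R^-1 t 1 _ d1.
  have d3 := is_deriveD (is_derive_id t 1) d2.
  by apply: is_derive_eq d3 _; rewrite /GRing.scale/=; field.
have dcos (t : R) : is_derive t 1
    (fun t => t - k%:~R^-1 * cos (k%:~R * t)) (1 + sin (k%:~R * t)).
  have d1 := is_derive1_comp (is_derive_cos (k%:~R * t)) (km t).
  have d2 := @is_deriveZ _ _ _ _ k%:~R^-1 t 1 _ d1.
  have d3 := is_deriveB (is_derive_id t 1) d2.
  by apply: is_derive_eq d3 _; rewrite /GRing.scale/=; field.
have ck (h : R -> R) : continuous h -> continuous (fun t : R => 1 + h (k%:~R * t)).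
  move=> ch t; apply: continuousD; first exact: cst_continuous.
  apply: continuous_comp; last exact: ch.
  by apply: continuousM => //; exact: cvg_cst.
split.
- have : \int[mu]_t (1 + cos (k%:~R * t)) = 1.
    rewrite (Rintegral_arclength_ftc _ _ dsin).
    + by rewrite mulr0 ends ?sin0 ?mulr0 ?addr0 ?subr0 ?mulVf//; exact: sinD2pi.
    + by move=> t; have := cos_geN1 (k%:~R * t); lra.
    + by apply: ck; exact: continuous_cos.
  rewrite RintegralD//; [by rewrite c1; lra|exact: arclength_integrable_cst|].
  exact: sqint_integrable.
- have : \int[mu]_t (1 + sin (k%:~R * t)) = 1.
    rewrite (Rintegral_arclength_ftc _ _ dcos).
    + rewrite mulr0 ends ?cos0; last exact: cosD2pi.
      by rewrite sub0r opprK subrK mulVf.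
    + by move=> t; have := sin_geN1 (k%:~R * t); lra.
    + by apply: ck; exact: continuous_sin.
  rewrite RintegralD//; [by rewrite c1; lra|exact: arclength_integrable_cst|].
  exact: sqint_integrable.
Qed.

End CircleFunctions.

(** * Trigonometric polynomials and dominated convergence *)

Section TrigonometricDensity.
Context {R : realType}.
Local Notation mu := (@arclength R).
Implicit Types (u v : R -> R[i]) (r s T : R -> R) (A B : set R).

(** A Laurent polynomial in [circ t] is a trigonometric polynomial in [t]; one power
    [N] absorbs all the negative exponents. *)
Definition laurent (p : {poly R[i]}) (N : nat) (t : R) : R[i] :=
  p.[circ t] / circ t ^+ N.

Lemma bounded_laurent p N : bounded_mfun (laurent p N).
Proof.
apply: bounded_mfunM; first exact: bounded_mfun_horner.
rewrite (_ : (fun t => _) = fun t => circ t ^ (- N%:Z)); first exact: bounded_mfun_circXz.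
by apply/funext => t; rewrite -exprnN.
Qed.

Definition trigpoly T := exists p N, forall t, (T t)%:C = laurent p N t.

Lemma trigpoly_cst k : trigpoly (fun=> k).
Proof. by exists (k%:C)%:P, 0%N => t; rewrite /laurent hornerC expr0 divr1. Qed.

Lemma trigpolyM r s : trigpoly r -> trigpoly s -> trigpoly (fun t => r t * s t).
Proof.
move=> [p [N rp]] [q [M sE]]; exists (p * q), (N + M)%N => t.
by rewrite rmorphM /= rp sE /laurent hornerM exprD invfM mulrACA.
Qed.

Lemma trigpolyD r s : trigpoly r -> trigpoly s -> trigpoly (fun t => r t + s t).
Proof.
move=> [p [N rp]] [q [M sE]]; exists (p * 'X^M + q * 'X^N), (N + M)%N => t.
rewrite rmorphD /= rp sE /laurent !hornerE exprD.
by field; rewrite !expf_neq0 ?circ_neq0.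
Qed.

Lemma trigpolyZ k r : trigpoly r -> trigpoly (fun t => k * r t).
Proof. by apply: trigpolyM; exact: trigpoly_cst. Qed.

Lemma trigpolyB r s : trigpoly r -> trigpoly s -> trigpoly (fun t => r t - s t).
Proof.
move=> tr /(trigpolyZ (-1)) ts; have := trigpolyD tr ts.
by under eq_fun do rewrite mulN1r.
Qed.

Lemma trigpolyX r m : trigpoly r -> trigpoly (fun t => r t ^+ m).
Proof.
move=> tr; elim: m => [|m IH].
  by under eq_fun do rewrite expr0; exact: trigpoly_cst.
by under eq_fun do rewrite exprS; exact: trigpolyM.
Qed.

Lemma circV t : (circ t : R[i])^-1 = cos t -i* sin t.
Proof.
apply: (mulfI (circ_neq0 t)); rewrite divff ?circ_neq0//.
apply/eqP; rewrite eq_complex cReM cImM /= mulrN opprK -!expr2 cos2Dsin2.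
by rewrite mulrN mulrC addNr !eqxx.
Qed.

Lemma trigpoly_cos : trigpoly cos.
Proof.
exists ((2^-1)%:P * ('X^2 + 1)), 1%N => t.
rewrite /laurent expr1 !hornerE -mulrA mulrDl mul1r expr2 mulfK ?circ_neq0//.
rewrite circV; apply: (mulfI (x := 2)); first by rewrite pnatr_eq0.
rewrite mulVKf ?pnatr_eq0// mulr_natl mulr2n.
by apply/eqP; rewrite eq_complex /= addrN addr0 !eqxx.
Qed.

Lemma trigpoly_sin : trigpoly sin.
Proof.
exists (((2 * 'i)^-1)%:P * ('X^2 - 1)), 1%N => t.
rewrite /laurent expr1 !hornerE -mulrA mulrBl mul1r expr2 mulfK ?circ_neq0//.
have n0 : 2 * 'i != 0 :> R[i].
  by rewrite mulf_neq0 ?pnatr_eq0// eq_complex /= oner_eq0 andbF.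
rewrite circV; apply: (mulfI n0); rewrite mulVKf// -mulrA mulr_natl mulr2n.
by apply/eqP; rewrite eq_complex /=; apply/andP; split; apply/eqP; ring.
Qed.

Lemma trigpoly_sqint T : trigpoly T -> sqint T.
Proof.
move=> [p [N Tp]]; have [] := bounded_csqint (bounded_laurent p N).
by under [X in sqint X -> _]eq_fun do rewrite -Tp /=.
Qed.

Lemma small_dominated_integral (h : nat -> R -> R) (g : R -> R) :
  (forall n, measurable_fun [set: R] (h n)) ->
  mu.-integrable setT (EFin \o g) ->
  (forall n t, `|h n t| <= g t) ->
  {ae mu, forall t, h n t @[n --> \oo] --> (0 : R)} ->
  forall e : R, 0 < e -> exists n, \int[mu]_t `|h n t| < e.
Proof.
move=> mh ig hg h0 e e0.
pose H n := EFin \o (fun t => `|h n t|).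
have mh' n : measurable_fun [set: R] (H n).
  by apply/measurable_EFinP; exact: measurableT_comp.
have cv : {ae mu, forall t, [set: R] t -> H n t @[n --> \oo] --> cst 0%E t}.
  apply: filterS h0 => t ht _ /=; apply: cvg_EFin; first exact: nearW.
  by rewrite -[X in _ --> X](@normr0 R R); exact: cvg_norm.
have dm : {ae mu, forall t n, [set: R] t -> (`|H n t| <= (EFin \o g) t)%E}.
  by apply: nearW => t n _ /=; rewrite lee_fin normr_id.
have [_ _] := dominated_convergence (mu := mu) measurableT mh' (measurable_cst 0%E) cv ig dm.
rewrite integral0 => cvi.
case/fine_cvgP: cvi => _ /cvgrPdist_lt /(_ _ e0)[n _ /(_ n (leqnn n))] /=.
rewrite sub0r normrN ger0_norm; first by exists n.
by apply: fine_ge0; apply: integral_ge0 => t _ /=; rewrite lee_fin.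
Qed.

(** This lemma and the next one are the elementary device behind the Stone-Weierstrass
    theorem: the polynomials [(1 - x ^ n) ^ (2 ^ n)] map [[0, 1]] to itself and converge,
    off [1/2], to the indicator of the points below [1/2]. Here Bernoulli's inequality
    bounds them below by [1 - (2 x) ^ n]. *)
Lemma pow_lt_half (x : R) : 0 <= x < 2^-1 ->
  (1 - x ^+ n) ^+ (2 ^ n) @[n --> \oo] --> (1 : R).
Proof.
move=> /andP[x0 x1].
have lower n : 1 - (2 * x) ^+ n <= (1 - x ^+ n) ^+ (2 ^ n).
  have xn1 : x ^+ n <= 1 by rewrite exprn_ile1//; lra.
  rewrite exprMn -natrX.
  elim: (2 ^ n)%N => [|m IH]; first by rewrite expr0 mul0r subr0.
  rewrite exprS -natr1.
  have xn0 : 0 <= x ^+ n by exact: exprn_ge0.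
  have : 0 <= (1 - x ^+ n) ^+ m by rewrite exprn_ge0// subr_ge0.
  have : (1 - x ^+ n) ^+ m <= 1 by rewrite exprn_ile1//; lra.
  nra.
apply: (@squeeze_cvgr _ _ _ _ (fun n => 1 - (2 * x) ^+ n) (cst 1)).
- apply: nearW => n; rewrite lower /= exprn_ile1// ?subr_ge0 ?exprn_ile1//; last 2 first.
  + lra.
  + by rewrite lerBlDr lerDl exprn_ge0.
- rewrite -[X in _ --> X]subr0; apply: cvgB; first exact: cvg_cst.
  by apply: cvg_expr; rewrite ger0_norm; lra.
- exact: cvg_cst.
Qed.

(** Bernoulli's inequality in the form [(1 - y) ^ m (1 + m y) <= 1] bounds the power by
    [(2 x) ^ - n]. *)
Lemma pow_gt_half (x : R) : 2^-1 < x <= 1 ->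
  (1 - x ^+ n) ^+ (2 ^ n) @[n --> \oo] --> (0 : R).
Proof.
move=> /andP[x0 x1].
have upper n : (1 - x ^+ n) ^+ (2 ^ n) * (2 * x) ^+ n <= 1.
  have xn1 : x ^+ n <= 1 by rewrite exprn_ile1//; lra.
  have xn0 : 0 <= x ^+ n by rewrite exprn_ge0//; lra.
  rewrite exprMn -natrX.
  suff : forall m, (1 - x ^+ n) ^+ m * (1 + m%:R * x ^+ n) <= 1.
    move=> /(_ (2 ^ n)%N); apply: le_trans; rewrite ler_wpM2l ?lerDr//.
    by rewrite exprn_ge0// subr_ge0.
  elim=> [|m IH]; first by rewrite expr0 mul0r addr0 mulr1.
  rewrite exprS -natr1.
  have : 0 <= (1 - x ^+ n) ^+ m by rewrite exprn_ge0// subr_ge0.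
  have m0 : 0 <= (m%:R : R) by [].
  have m1 : 0 <= m%:R * x ^+ n * x ^+ n by rewrite !mulr_ge0.
  have m2 : 0 <= x ^+ n * x ^+ n by rewrite !mulr_ge0.
  move: m1 m2 IH; set y := x ^+ n in xn1 xn0 *; set z := (1 - y) ^+ m.
  nra.
have x2 : 1 < 2 * x by lra.
apply: (@squeeze_cvgr _ _ _ _ (cst 0) (fun n => (2 * x)^-1 ^+ n)).
- apply: nearW => n; apply/andP; split => /=.
    by rewrite exprn_ge0// subr_ge0 exprn_ile1//; lra.
  rewrite exprVn -[leRHS]mul1r ler_pdivlMr ?upper// exprn_gt0//; lra.
- exact: cvg_cst.
- apply: cvg_expr; rewrite ger0_norm ?invr_ge0 ?invf_lt1//; lra.
Qed.

End TrigonometricDensity.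

(** * Approximation of indicators by trigonometric polynomials *)

Section TrigonometricSets.
Context {R : realType}.
Local Notation mu := (@arclength R).
Implicit Types (r s T : R -> R) (A B : set R).

Lemma ae_in_itv : {ae mu, forall t, 0 <= t <= pi *+ 2}.
Proof.
exists (~` `[0, pi *+ 2]%classic); split.
- exact: measurableC.
- rewrite /arclength /= /uniform_prob integral_uniform_pdf setICl.
  exact: integral_set0.
- by move=> t /=; rewrite in_itv.
Qed.

Lemma ae_neq (a : R) : {ae mu, forall t, t != a}.
Proof.
exists [set a]; split.
- exact: measurable_set1.
- have /null_content_dominatesP := dominates_uniform_prob (@twopi_gt0 R).
  by apply; [exact: measurable_set1|exact: lebesgue_measure_set1].
- by move=> t /= /negP/negPn/eqP.
Qed.

(** Approximants with values in [[0, 1]] can be multiplied without losing control of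
    the error, so the sets of this kind are a sigma-algebra; moreover their L^1 error
    dominates the square of the L^2 error. *)
Definition trig_approx A := measurable A /\ forall e : R, 0 < e ->
  exists T, [/\ trigpoly T, forall t, 0 <= T t <= 1 & \int[mu]_t `|T t - \1_A t| < e].

Lemma indic_itv01 A t : 0 <= (\1_A t : R) <= 1.
Proof. by rewrite indicE; case: (_ \in _); rewrite ?ler01 ?lexx. Qed.

Lemma norm_sub01 (x y : R) : 0 <= x <= 1 -> 0 <= y <= 1 -> `|x - y| <= 1.
Proof. by move=> /andP[? ?] /andP[? ?]; rewrite ler_norml; apply/andP; split; lra. Qed.

Lemma measurable_trigpoly T : trigpoly T -> measurable_fun [set: R] T.
Proof. by move=> /trigpoly_sqint[]. Qed.

Lemma measurable_indicR A : measurable A ->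
  measurable_fun [set: R] (fun t => \1_A t : R).
Proof. by move=> mA; exact: (@measurable_indic _ _ R setT A mA). Qed.

Lemma indic_dist_int T A : measurable A -> measurable_fun [set: R] T ->
  (forall t, 0 <= T t <= 1) ->
  mu.-integrable setT (EFin \o (fun t => `|T t - \1_A t|)).
Proof.
move=> mA mT T01; apply: (integrable_le (s := cst 1)).
- apply: measurableT_comp => //; exact: measurable_funB.
- by move=> t; rewrite normr_id norm_sub01// indic_itv01.
- exact: arclength_integrable_cst.
Qed.

Lemma trig_approxC A : trig_approx A -> trig_approx (~` A).
Proof.
move=> [mA hA]; split; first exact: measurableC.
move=> e /hA[T [tT T01 Te]]; exists (fun t => 1 - T t); split.
- by apply: trigpolyB => //; exact: trigpoly_cst.
- by move=> t; have /andP[? ?] := T01 t; apply/andP; split; lra.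
- apply: le_lt_trans Te; rewrite le_eqVlt; apply/orP; left; apply/eqP.
  congr Rintegral; apply/funext => t; rewrite -normrN; congr `| _ |.
  rewrite !indicE in_setC; case: (t \in A) => /=; ring.
Qed.

Lemma trig_approxI A B : trig_approx A -> trig_approx B -> trig_approx (A `&` B).
Proof.
move=> [mA hA] [mB hB]; have mAB : measurable (A `&` B) by exact: measurableI.
split=> // e e0.
have e2 : 0 < e / 2 by rewrite divr_gt0.
have [T [tT T01 Te]] := hA _ e2; have [S [tS S01 Se]] := hB _ e2.
exists (fun t => T t * S t); split; first exact: trigpolyM.
- move=> t; have /andP[? ?] := T01 t; have /andP[? ?] := S01 t.
  by rewrite mulr_ge0//= mulr_ile1.
- apply: (@le_lt_trans _ _ (\int[mu]_t (`|T t - \1_A t| + `|S t - \1_B t|))).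
    apply: le_Rintegral => //.
    + apply: indic_dist_int => //.
        by apply: measurable_funM; exact: measurable_trigpoly.
      move=> t; have /andP[? ?] := T01 t; have /andP[? ?] := S01 t.
      by rewrite mulr_ge0//= mulr_ile1.
    + by apply: integrable_EFinD; apply: indic_dist_int => //; exact: measurable_trigpoly.
    + move=> t _; rewrite indicI /=.
      have -> : T t * S t - \1_A t * \1_B t =
        (T t - \1_A t) * S t + \1_A t * (S t - \1_B t) by ring.
      rewrite (le_trans (ler_normD _ _))// lerD// normrM.
        by rewrite ler_piMr// ger0_norm; case/andP: (S01 t).
      by rewrite ler_piMl// ger0_norm; case/andP: (indic_itv01 A t).
  rewrite RintegralD//; first lra.
  + by apply: indic_dist_int => //; exact: measurable_trigpoly.
  + by apply: indic_dist_int => //; exact: measurable_trigpoly.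
Qed.

Lemma trig_approx_seq A (T : nat -> R -> R) : measurable A ->
  (forall n, trigpoly (T n)) -> (forall n t, 0 <= T n t <= 1) ->
  {ae mu, forall t, T n t @[n --> \oo] --> (\1_A t : R)} -> trig_approx A.
Proof.
move=> mA tT T01 cT; split=> // e e0.
have [n ne] : exists n, \int[mu]_t `|T n t - \1_A t| < e.
  apply: (@small_dominated_integral _ (fun n t => T n t - \1_A t) (cst 1)) => //.
  - move=> n; apply: measurable_funB; first exact: measurable_trigpoly.
    exact: measurable_indicR.
  - exact: arclength_integrable_cst.
  - by move=> n t; rewrite norm_sub01// indic_itv01.
  - apply: filterS cT => t ct; rewrite -(subrr (\1_A t : R)).
    by apply: cvgB => //; exact: cvg_cst.
by exists (T n).
Qed.

Lemma trig_approx_set0 : trig_approx set0.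
Proof.
apply: (@trig_approx_seq _ (fun _ _ => 0)) => //.
- by move=> n; exact: trigpoly_cst.
- by move=> n t; rewrite lexx ler01.
- by apply: nearW => t; rewrite indic0; exact: cvg_cst.
Qed.

(** The indicators of the finite unions converge boundedly to that of the union. *)
Lemma trig_approx_bigcup (F : nat -> set R) : (forall i, trig_approx (F i)) ->
  trig_approx (\bigcup_i F i).
Proof.
move=> hF; pose G n := \big[setU/set0]_(i < n) F i.
have hG n : trig_approx (G n).
  rewrite /G; elim: n => [|n IH].
    by rewrite big_ord0; exact: trig_approx_set0.
  rewrite big_ord_recr /= -[X in trig_approx X]setCK setCU.
  by apply/trig_approxC/trig_approxI; exact: trig_approxC.
have mU : measurable (\bigcup_i F i) by apply: bigcupT_measurable => i; have [] := hF i.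
split=> // e e0; have e2 : 0 < e / 2 by rewrite divr_gt0.
have mG n : measurable (G n) by have [] := hG n.
have [n ne] : exists n, \int[mu]_t `|\1_(G n) t - \1_(\bigcup_i F i) t| < e / 2.
  apply: (@small_dominated_integral _
    (fun n t => \1_(G n) t - \1_(\bigcup_i F i) t) (cst 1)) => //.
  - by move=> n; apply: measurable_funB; exact: measurable_indicR.
  - exact: arclength_integrable_cst.
  - by move=> n t; rewrite norm_sub01// indic_itv01.
  - apply: nearW => t.
    have [[i _ Fit]|Ut] := pselect ((\bigcup_i F i) t).
      apply: cvg_near_cst; exists i.+1 => // n /= ni.
      have Gnt : G n t by rewrite /G -bigcup_mkord; exists i.
      have Ut : (\bigcup_i F i) t by exists i.
      by rewrite !indicE (mem_set Gnt) (mem_set Ut) subrr.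
    apply: cvg_near_cst; apply: nearW => n.
    have Gnt : ~ G n t.
      by rewrite /G -bigcup_mkord => -[i _ Fit]; apply: Ut; exists i.
    by rewrite !indicE (memNset Gnt) (memNset Ut) subrr.
have [_ /(_ _ e2)[T [tT T01 Te]]] := hG n; exists T; split=> //.
  apply: (@le_lt_trans _ _ (\int[mu]_t
      (`|T t - \1_(G n) t| + `|\1_(G n) t - \1_(\bigcup_i F i) t|))).
    have i1 := indic_dist_int (mG n) (measurable_trigpoly tT) T01.
    apply: le_Rintegral => //.
    + by apply: indic_dist_int => //; exact: measurable_trigpoly.
    + apply: integrable_EFinD => //; apply: indic_dist_int => //.
      exact: indic_itv01.
    + by move=> t _; exact: ler_distD.
  rewrite RintegralD//; first lra.
  + by apply: indic_dist_int => //; exact: measurable_trigpoly.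
  + by apply: indic_dist_int => //; exact: indic_itv01.
Qed.

(** Let [0 < a < 2 pi], the other cases being those of null sets and their complements.
    Within [(0, 2 pi)] the set is the arc [(0, a)]. As a function of [t],
    [sin (t / 2) sin ((a - t) / 2)] is a trigonometric polynomial of degree one, positive
    on [(0, a)] and negative on [(a, 2 pi)]; composing the powers of [pow_lt_half] with
    [1/2] minus half of it gives the approximants. *)
Lemma trig_approx_itvNyo (a : R) : trig_approx `]-oo, a[%classic.
Proof.
have mA : measurable `]-oo, a[%classic by exact: measurable_itv.
have [a0|a0] := leP a 0.
  apply: (@trig_approx_seq _ (fun _ _ => 0)) => //.
  - by move=> n; exact: trigpoly_cst.
  - by move=> n t; rewrite lexx ler01.
  - apply: filterS ae_in_itv => t /andP[t0 _].
    rewrite indicE memNset; first exact: cvg_cst.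
    by rewrite /= in_itv /=; apply/negP; rewrite -leNgt (le_trans a0).
have [a1|a1] := leP (pi *+ 2) a.
  apply: (@trig_approx_seq _ (fun _ _ => 1)) => //.
  - by move=> n; exact: trigpoly_cst.
  - by move=> n t; rewrite lexx ler01.
  - apply: filterS (filterI ae_in_itv (ae_neq (pi *+ 2))) => t [/andP[_ t1] t2].
    rewrite indicE mem_set; first exact: cvg_cst.
    by rewrite /= in_itv /= (lt_le_trans _ a1)// lt_neqAle t2.
pose x t := 2^-1 - 2^-1 * (sin (t / 2) * sin ((a - t) / 2)).
have xE t : x t = (2^-1 + 4^-1 * cos (a / 2)) +
    ((- 4^-1 * cos (a / 2)) * cos t + (- 4^-1 * sin (a / 2)) * sin t).
  have : cos (a / 2) = cos (t / 2 + (a - t) / 2) by congr cos; field.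
  have : cos (a / 2 - t) = cos (t / 2 - (a - t) / 2) by rewrite -cosN; congr cos; field.
  by rewrite /x !cosB !cosD; lra.
have tx : trigpoly x.
  rewrite (funext xE); apply: trigpolyD; first exact: trigpoly_cst.
  by apply: trigpolyD; apply: trigpolyZ; [exact: trigpoly_cos|exact: trigpoly_sin].
have ss t : -1 <= sin (t / 2) * sin ((a - t) / 2) <= 1.
  have := sin_geN1 (t / 2); have := sin_le1 (t / 2).
  have := sin_geN1 ((a - t) / 2); have := sin_le1 ((a - t) / 2).
  by move=> *; apply/andP; split; nra.
have x01 t : 0 <= x t <= 1.
  by have /andP[? ?] := ss t; rewrite /x; apply/andP; split; lra.
apply: (@trig_approx_seq _ (fun n t => (1 - x t ^+ n) ^+ (2 ^ n))) => //.
- by move=> n; apply/trigpolyX/trigpolyB; [exact: trigpoly_cst|exact: trigpolyX].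
- move=> n t; have /andP[? ?] := x01 t.
  have xn1 : x t ^+ n <= 1 by rewrite exprn_ile1.
  have xn0 : 0 <= x t ^+ n by rewrite exprn_ge0.
  by rewrite exprn_ge0 ?subr_ge0//= exprn_ile1 ?subr_ge0//; lra.
- apply: filterS (filterI (filterI ae_in_itv (ae_neq (pi *+ 2)))
    (filterI (ae_neq 0) (ae_neq a))) => t [[/andP[t0 t2] tn2] [tn0 tna]].
  have t0' : 0 < t by rewrite lt_neqAle eq_sym tn0.
  have t2' : t < pi *+ 2 by rewrite lt_neqAle tn2.
  move: (t2') (a1); rewrite mulr2n => t2p a1p.
  have s1 : 0 < sin (t / 2) by apply: sin_gt0_pi; apply/andP; split; lra.
  have [ta|ta] := ltP t a.
    rewrite indicE mem_set /= ?in_itv//; apply: pow_lt_half.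
    have s2 : 0 < sin ((a - t) / 2) by apply: sin_gt0_pi; apply/andP; split; lra.
    have := mulr_gt0 s1 s2; have /andP[] := x01 t; rewrite {2}/x => -> _ ?.
    by rewrite /x; lra.
  have ta' : a < t by rewrite lt_neqAle eq_sym tna.
  rewrite indicE memNset /=; last by rewrite in_itv /=; apply/negP; rewrite -leNgt.
  apply: pow_gt_half.
  have s2 : 0 < sin ((t - a) / 2) by apply: sin_gt0_pi; apply/andP; split; lra.
  have := mulr_gt0 s1 s2; have /andP[_ ->] := x01 t; rewrite andbT.
  have -> : (t - a) / 2 = - ((a - t) / 2) by field.
  by rewrite sinN /x; lra.
Qed.

Lemma trig_approx_measurable A : measurable A -> trig_approx A.
Proof.
move=> mA; have : (@RGenInftyO.G R).-sigma.-measurable A.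
  by rewrite -RGenInftyO.measurableE.
apply; split.
- split.
  + exact: trig_approx_set0.
  + by move=> B /trig_approxC; rewrite setTD.
  + exact: trig_approx_bigcup.
- by move=> _ [a ->]; exact: trig_approx_itvNyo.
Qed.

End TrigonometricSets.

(** * Density of the trigonometric polynomials *)

Section Density.
Context {R : realType}.
Local Notation mu := (@arclength R).
Implicit Types (u v : R -> R[i]) (r s T : R -> R) (A B : set R).

Definition trig_dense u := forall e : R, 0 < e ->
  exists p N, l2norm (fun t => u t - laurent p N t) < e.

Lemma csqint_laurent (p : {poly R[i]}) N : csqint (laurent p N).
Proof. exact/bounded_csqint/bounded_laurent. Qed.

Lemma trig_denseD u v : csqint u -> csqint v -> trig_dense u -> trig_dense v ->
  trig_dense (fun t => u t + v t).
Proof.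
move=> su sv du dv e e0; have e2 : 0 < e / 2 by rewrite divr_gt0.
have [p [N pe]] := du _ e2; have [q [M qe]] := dv _ e2.
exists (p * 'X^M + q * 'X^N), (N + M)%N.
rewrite (_ : (fun t => _) =
    fun t => (u t - laurent p N t) + (v t - laurent q M t)); last first.
  apply/funext => t /=; rewrite /laurent hornerD !hornerM !hornerXn exprD.
  by field; rewrite !expf_neq0 ?circ_neq0.
have sp := csqint_laurent p N; have sq := csqint_laurent q M.
apply: le_lt_trans (l2normD _ _) _; [exact: csqintB..|lra].
Qed.

Lemma trig_denseZ (c : R[i]) u : csqint u -> trig_dense u ->
  trig_dense (fun t => c * u t).
Proof.
move=> su du e e0.
have c1 : 0 < normc c + 1 by rewrite ltr_wpDl ?normc_ge0.
have [p [N pe]] := du _ (divr_gt0 e0 c1).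
exists (c *: p), N.
rewrite (_ : (fun t => _) = fun t => c * (u t - laurent p N t)); last first.
  by apply/funext => t; rewrite /laurent hornerZ mulrBr mulrA.
rewrite l2normZ; last by apply: csqintB => //; exact: csqint_laurent.
rewrite ltr_pdivlMr// mulrC in pe; apply: le_lt_trans pe.
by rewrite ler_wpM2r ?l2norm_ge0// lerDl.
Qed.

Lemma trig_dense_lim u : csqint u ->
  (forall e : R, 0 < e ->
     exists v, [/\ csqint v, trig_dense v & l2norm (fun t => u t - v t) < e]) ->
  trig_dense u.
Proof.
move=> su hu e e0; have e2 : 0 < e / 2 by rewrite divr_gt0.
have [v [sv dv uv]] := hu _ e2; have [p [N pe]] := dv _ e2; exists p, N.
rewrite (_ : (fun t => _) = fun t => (u t - v t) + (v t - laurent p N t)); last first.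
  by apply/funext => t; rewrite addrA subrK.
have sp := csqint_laurent p N.
apply: le_lt_trans (l2normD _ _) _; [exact: csqintB..|lra].
Qed.

Lemma csqint_real r : sqint r -> csqint (fun t => (r t)%:C).
Proof. by move=> sr; split => //=; exact: sqint_cst. Qed.

Lemma l2norm_real r : l2norm (fun t => (r t)%:C) = Num.sqrt (\int[mu]_t (r t ^+ 2)).
Proof.
rewrite /l2norm /dot; congr (Num.sqrt (Rintegral _ _ _)); apply/funext => t /=.
by rewrite mulr0 addr0 expr2.
Qed.

Lemma sqrtr_lt (x e : R) : 0 < e -> x < e ^+ 2 -> Num.sqrt x < e.
Proof.
by move=> e0 xe; rewrite -[e]gtr0_norm// -sqrtr_sqr ltr_sqrt// exprn_gt0.
Qed.

Lemma sqint_indic A : measurable A -> sqint (\1_A : R -> R).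
Proof.
move=> mA; apply: (sqint_bnd (C := 1)); first exact: measurable_indicR.
by move=> t; have /andP[? ?] := indic_itv01 A t; rewrite ger0_norm.
Qed.

Lemma trig_dense_indic A : measurable A -> trig_dense (fun t => (\1_A t)%:C).
Proof.
move=> mA e e0; have e2 : 0 < e ^+ 2 by rewrite exprn_gt0.
have [_ /(_ _ e2)[T [tT T01 Te]]] := trig_approx_measurable mA.
have [p [N Tp]] := tT; exists p, N.
rewrite (_ : (fun t => _) = fun t => (\1_A t - T t)%:C); last first.
  by apply/funext => t; rewrite -Tp rmorphB.
rewrite l2norm_real; apply: sqrtr_lt => //; apply: le_lt_trans Te.
have [mT iT] := trigpoly_sqint tT.
apply: le_Rintegral => //.
- by have [] := sqintB (sqint_indic mA) (trigpoly_sqint tT).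
- exact: indic_dist_int.
- move=> t _; rewrite -[leLHS]real_normK ?num_real// distrC.
  by rewrite expr2 ler_piMr// norm_sub01// indic_itv01.
Qed.

Lemma trig_dense_sum n (c : 'I_n -> R) (A : 'I_n -> set R) :
  (forall i, measurable (A i)) ->
  sqint (fun t => \sum_(i < n) c i * \1_(A i) t) /\
  trig_dense (fun t => (\sum_(i < n) c i * \1_(A i) t)%:C).
Proof.
elim: n c A => [|n IH] c A mA.
  split; first by under eq_fun do rewrite big_ord0; exact: sqint_cst.
  move=> e e0; exists 0, 0%N; rewrite (_ : (fun t => _) = fun=> 0%:C).
    by rewrite l2norm_real expr0n /= Rintegral_cst// mul0r sqrtr0.
  by apply/funext => t; rewrite big_ord0 /laurent horner0 mul0r subr0.
have [sI dI] := IH (fun i => c (lift ord0 i)) (fun i => A (lift ord0 i)) (fun i => mA _).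
have s0 := sqint_indic (mA ord0).
split.
  by under eq_fun do rewrite big_ord_recl; apply: sqintD => //; exact: sqintZ.
under eq_fun do rewrite big_ord_recl rmorphD rmorphM /=.
apply: trig_denseD.
- exact/csqintZ/csqint_real.
- exact: csqint_real.
- by apply: trig_denseZ; [exact: csqint_real|exact: trig_dense_indic].
- exact: dI.
Qed.

(** Simple functions increase to [r] and [(r - S n) ^ 2] is dominated by [r ^ 2]. *)
Lemma trig_dense_ge0 r : sqint r -> (forall t, 0 <= r t) ->
  trig_dense (fun t => (r t)%:C).
Proof.
move=> sr r0; have [mr ir] := sr.
have mr' : measurable_fun [set: R] (EFin \o r) by exact/measurable_EFinP.
have r0' (t : R) : [set: R] t -> (0 <= (EFin \o r) t)%E by rewrite lee_fin.
pose S := nnsfun_approx measurableT mr'.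
have S0 n t : 0 <= S n t by [].
have Sr n t : S n t <= r t.
  by rewrite -lee_fin nnsfun_approxE; exact: (@le_approx _ _ _ _ (EFin \o r) n t r0').
have cS t : S n t @[n --> \oo] --> r t.
  have := cvg_nnsfun_approx measurableT mr' r0' (x := t) I.
  by move/fine_cvgP => -[].
have mS n : measurable_fun [set: R] (S n) by [].
have mSi n y : measurable (S n @^-1` [set y]) by [].
apply: trig_dense_lim; first exact: csqint_real.
move=> e e0; have e2 : 0 < e ^+ 2 by rewrite exprn_gt0.
have [n ne] : exists n, \int[mu]_t `|(r t - S n t) ^+ 2| < e ^+ 2.
  apply: (@small_dominated_integral _ (fun n t => (r t - S n t) ^+ 2) (fun t => r t ^+ 2)) => //.
  - by move=> n; apply: measurable_funX; exact: measurable_funB.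
  - move=> n t; rewrite ger0_norm ?sqr_ge0//.
    by have := S0 n t; have := Sr n t; nra.
  - apply: nearW => t; under eq_fun do rewrite expr2.
    have c0 : r t - S n t @[n --> \oo] --> (0 : R).
      by rewrite -(subrr (r t)); apply: cvgB => //; exact: cvg_cst.
    by have := cvgM c0 c0; rewrite mulr0; apply.
have [sS dS] : sqint (S n) /\ trig_dense (fun t => (S n t)%:C).
  rewrite (funext (fimfunEord (S n))).
  exact: trig_dense_sum.
exists (fun t => (S n t)%:C); split => //; first exact: csqint_real.
under eq_fun do rewrite -rmorphB.
rewrite l2norm_real; apply: sqrtr_lt => //; apply: le_lt_trans ne.
rewrite le_eqVlt; apply/orP; left; apply/eqP; congr Rintegral.
by apply/funext => t; rewrite ger0_norm ?sqr_ge0.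
Qed.

Lemma trig_dense_real r : sqint r -> trig_dense (fun t => (r t)%:C).
Proof.
move=> sr.
have sM s : sqint s -> sqint (fun t => Num.max (s t) 0).
  move=> [ms is_]; split; first exact: measurable_maxr.
  apply: (integrable_le (s := fun t => s t ^+ 2)) => //.
    by apply: measurable_funX; exact: measurable_maxr.
  move=> t; rewrite ger0_norm ?sqr_ge0//.
  by case: (leP (s t) 0) => h; rewrite ?expr0n ?sqr_ge0.
rewrite (_ : (fun t => _) =
  fun t => (Num.max (r t) 0)%:C + (-1)%:C * (Num.max (- r t) 0)%:C); last first.
  apply/funext => t; rewrite -rmorphM -rmorphD /=; congr _%:C.
  by case: (leP (r t) 0) => h; case: (leP (- r t) 0) => h'; lra.
have sN := sqintN sr.
apply: trig_denseD.
- exact/csqint_real/sM.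
- exact/csqintZ/csqint_real/sM.
- by apply: trig_dense_ge0; [exact: sM|move=> t; rewrite le_max lexx orbT].
- apply: trig_denseZ; first exact/csqint_real/sM.
  by apply: trig_dense_ge0; [exact: sM|move=> t; rewrite le_max lexx orbT].
Qed.

(** This is what links the Hardy spaces, which are given by conditions on Fourier
    coefficients, to the geometry of L^2. *)
Lemma trig_dense_csqint u : csqint u -> trig_dense u.
Proof.
move=> [ru iu]; rewrite (_ : u = fun t => (Re (u t))%:C + 'i * (Im (u t))%:C).
  apply: trig_denseD.
  - exact: csqint_real.
  - exact/csqintZ/csqint_real.
  - exact: trig_dense_real.
  - by apply: trig_denseZ; [exact: csqint_real|exact: trig_dense_real].
by apply/funext => t; rewrite -complexE.
Qed.

End Density.

(** * Fourier coefficients and orthogonality *)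

Section Fourier.
Context {R : realType}.
Local Notation mu := (@arclength R).
Implicit Types (u v : R -> R[i]) (f g : R[i] -> R[i]) (p q : {poly R[i]}).

Definition on_param f : R -> R[i] := fun t => f (circ t).

Lemma Lpnorm2_integral f : Lpnorm 2%:E f =
  ((\int[mu]_t (normc (f (circ t)) ^+ 2)%:E) `^ 2^-1)%E.
Proof.
rewrite /Lpnorm unlock; congr (_ `^ _)%E; apply: eq_integral => t _.
by rewrite /= ger0_norm ?normc_ge0// powR_mulrn// normc_ge0.
Qed.

Lemma Lpnorm2E f : csqint (on_param f) -> Lpnorm 2%:E f = (l2norm (on_param f))%:E.
Proof.
move=> sf; have si := l2norm_int sf.
rewrite Lpnorm2_integral /l2norm dotuu -powR12_sqrt; last first.
  by apply: Rintegral_ge0 => t _; exact: sqr_ge0.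
rewrite -poweR_EFin; congr (_ `^ _)%E; rewrite /Rintegral fineK//.
exact: integrable_fin_num.
Qed.

Lemma L2P f : L2 f <-> csqint (on_param f).
Proof.
split=> [[mr mi nf]|sf]; last first.
  have [[mr _] [mi _]] := sf; split=> //.
  by rewrite Lpnorm2E// ltry.
have mn : measurable_fun [set: R] (fun t => normc (f (circ t)) ^+ 2).
  under eq_fun do rewrite normc_sqr.
  by apply: measurable_funD; exact: measurable_funX.
have fi : mu.-integrable setT (EFin \o (fun t => normc (f (circ t)) ^+ 2)).
  apply/integrableP; split; first exact/measurable_EFinP.
  under eq_integral do rewrite /= ger0_norm ?sqr_ge0//.
  by move: nf; rewrite Lpnorm2_integral; apply: lty_poweRy; rewrite invr_eq0.
split; split=> //; apply: (integrable_le (s := fun t => normc (f (circ t)) ^+ 2)) => //.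
- exact: measurable_funX.
- by move=> t; rewrite ger0_norm ?sqr_ge0// normc_sqr lerDl sqr_ge0.
- exact: measurable_funX.
- by move=> t; rewrite ger0_norm ?sqr_ge0// normc_sqr lerDr sqr_ge0.
Qed.

Lemma on_param_ext f g : (forall t, f (circ t) = g (circ t)) ->
  on_param f = on_param g.
Proof. by move=> fg; apply/funext. Qed.

Lemma fourier_ext f g k : (forall t, f (circ t) = g (circ t)) ->
  fourier f k = fourier g k.
Proof.
move=> fg; rewrite /fourier /circle_integral.
by congr Complex; congr Rintegral; apply/funext => t; rewrite fg.
Qed.

Lemma conj_circXz t (k : int) : ((circ t : R[i]) ^ k)^* = circ t ^ (- k).
Proof. by rewrite !circXz /= rmorphN mulNr /circ cosN sinN. Qed.

(** Fourier coefficients are read off the real inner product, the scalar [c] giving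
    access to both their real and imaginary parts. *)
Lemma fourier_dot f (c : R[i]) k : csqint (on_param f) ->
  Re (c^* * fourier f k) = dot (on_param f) (fun t => c * circ t ^ k).
Proof.
move=> sf; rewrite cReM /fourier /circle_integral.
have : csqint (fun t => f (circ t) * circ t ^ (- k)).
  have := csqint_bndM (bounded_mfun_circXz (- k)) sf.
  by under eq_fun do rewrite mulrC.
move=> [/sqint_integrable sr /sqint_integrable si].
have -> : Re c^* = Re c by case: (c).
have -> : Im c^* = - Im c by case: (c).
rewrite /= mulNr opprK -!RintegralZl// -RintegralD//; [|exact: integrable_EFinZ..].
rewrite /dot; congr Rintegral; apply/funext => t; rewrite /on_param -conj_circXz.
move: (f (circ t)) ((circ t : R[i]) ^ k) => x y.
by case: x => x1 x2; case: y => y1 y2; case: (c) => c1 c2 /=; ring.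
Qed.

Lemma eq_by_Re (x y : R[i]) : (forall c : R[i], Re (c^* * x) = Re (c^* * y)) -> x = y.
Proof.
move=> xy; have := xy 1; have := xy 'i.
case: x xy => a b _; case: y => a' b' /= h1 h2.
by apply/eqP; rewrite eq_complex /=; apply/andP; split; apply/eqP; lra.
Qed.

Lemma fourierD f g k : csqint (on_param f) -> csqint (on_param g) ->
  fourier (fun z => f z + g z) k = fourier f k + fourier g k.
Proof.
move=> sf sg; apply: eq_by_Re => c.
have sfg : csqint (on_param (fun z => f z + g z)) by exact: csqintD.
have sz := csqintZ c (bounded_csqint (bounded_mfun_circXz k)).
by rewrite mulrDr cReD !fourier_dot// -dotDl.
Qed.

Lemma fourierZ f (a : R[i]) k : csqint (on_param f) ->
  fourier (fun z => a * f z) k = a * fourier f k.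
Proof.
move=> sf; apply: eq_by_Re => c.
have sfg : csqint (on_param (fun z => a * f z)) by exact: csqintZ.
have -> : Re (c^* * (a * fourier f k)) = Re ((a^* * c)^* * fourier f k).
  by case: (fourier f k) => x y; case: (c) => c1 c2; case: (a) => a1 a2 /=; ring.
rewrite !fourier_dot// /dot; congr Rintegral; apply/funext => t.
rewrite /on_param; move: (f (circ t)) ((circ t : R[i]) ^ k) => x y.
by case: x => x1 x2; case: y => y1 y2; case: (c) => c1 c2; case: (a) => a1 a2 /=; ring.
Qed.

Lemma fourierB f g k : csqint (on_param f) -> csqint (on_param g) ->
  fourier (fun z => f z - g z) k = fourier f k - fourier g k.
Proof.
move=> sf sg; rewrite -[in RHS]mulN1r -fourierZ// -fourierD//; last exact: csqintZ.
by apply: fourier_ext => t; rewrite mulN1r.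
Qed.

Lemma fourierX f k : fourier (fun z => z * f z) k = fourier f (k - 1).
Proof.
rewrite /fourier /circle_integral.
suff H t : (circ t * f (circ t)) * circ t ^ (- k) = f (circ t) * circ t ^ (- (k - 1)) :> R[i].
  by congr Complex; congr Rintegral; apply/funext => t; rewrite H.
by rewrite opprB addrC expfzDr ?circ_neq0// expr1z; ring.
Qed.

Lemma l2norm_unimodular u : (forall t, normc (u t) = 1) -> l2norm u = 1.
Proof.
move=> u1; rewrite /l2norm dotuu; under eq_Rintegral do rewrite u1 expr1n.
rewrite Rintegral_cst// mul1r [X in fine X](_ : _ = 1%E) ?sqrtr1//.
exact: probability_setT.
Qed.

Lemma normc_circXz t (k : int) : normc ((circ t : R[i]) ^ k) = 1.
Proof. by rewrite circXz normc_circ. Qed.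

(** The factor 2 comes from estimating the real and imaginary parts separately. *)
Lemma normc_fourier_le f k : csqint (on_param f) ->
  normc (fourier f k) <= 2 * l2norm (on_param f).
Proof.
move=> sf; have sz := bounded_csqint (@bounded_mfun_circXz R k).
have H (c : R[i]) : normc c = 1 -> `|Re (c^* * fourier f k)| <= l2norm (on_param f).
  move=> c1; rewrite fourier_dot//.
  apply: le_trans (normr_dot_le sf (csqintZ c sz)) _.
  by rewrite l2normZ// c1 (l2norm_unimodular (normc_circXz^~ k)) !mulr1.
apply: le_trans (normc_le_ReIm _) _; rewrite mulr_natl mulr2n lerD//.
  have -> : Re (fourier f k) = Re (1^* * fourier f k).
    by case: (fourier f k) => a b /=; ring.
  by apply: H; exact: normc1.
have -> : Im (fourier f k) = Re ('i^* * fourier f k).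
  by case: (fourier f k) => a b /=; ring.
by apply: H; rewrite /= expr0n expr1n add0r sqrtr1.
Qed.

Lemma fourier_cst (c : R[i]) k : fourier (fun=> c) k = if k == 0 then c else 0.
Proof.
have s1 : csqint (on_param (fun=> 1)) by exact/bounded_csqint/bounded_mfun_cst.
rewrite (@fourier_ext _ (fun z => c * 1)); last by move=> t; rewrite mulr1.
rewrite fourierZ// /fourier /circle_integral.
have -> : (fun t => Re (1 * (circ t : R[i]) ^ (- k))) = fun t => cos ((- k)%:~R * t).
  by apply/funext => t; rewrite mul1r circXz.
have -> : (fun t => Im (1 * (circ t : R[i]) ^ (- k))) = fun t => sin ((- k)%:~R * t).
  by apply/funext => t; rewrite mul1r circXz.
case: eqVneq => [->|k0].
  rewrite oppr0; under eq_Rintegral do rewrite mul0r cos0.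
  under [X in _ +i* X]eq_Rintegral do rewrite mul0r sin0.
  rewrite !Rintegral_cst// mul0r mul1r [X in fine X](_ : _ = 1%E).
    by rewrite mulr1.
  exact: probability_setT.
by have [|-> ->] := @Rintegral_cos_sin R (- k); rewrite ?oppr_eq0 ?mulr0.
Qed.

Lemma csqint_horner p : csqint (on_param (fun z => p.[z])).
Proof. exact/bounded_csqint/bounded_mfun_horner. Qed.

Lemma fourier_horner p (k : int) :
  fourier (fun z => p.[z]) k = if 0 <= k then p`_(`|k|) else 0.
Proof.
elim/poly_ind: p k => [|p c IH] k.
  rewrite (@fourier_ext _ (fun=> 0)); last by move=> t; rewrite horner0.
  by rewrite fourier_cst coef0; case: ifP; case: ifP.
rewrite (@fourier_ext _ (fun z => z * p.[z] + c)); last first.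
  by move=> t; rewrite hornerMXaddC mulrC.
rewrite fourierD; last 2 first.
- apply: csqint_bndM; [exact: bounded_mfun_circ|exact: csqint_horner].
- exact/bounded_csqint/bounded_mfun_cst.
rewrite fourierX IH fourier_cst coefD coefMX coefC.
case: k => [[|m]|m] /=.
- by rewrite add0r.
- by rewrite subn1.
- by rewrite addr0.
Qed.

Lemma horner_H2 p : H2 (fun z => p.[z]).
Proof.
split; first by apply/L2P; exact: csqint_horner.
by move=> k k0; rewrite fourier_horner leNgt k0.
Qed.

Lemma csqint0 : csqint (fun=> 0 : R[i]).
Proof. exact/bounded_csqint/bounded_mfun_cst. Qed.

Lemma csqint_sum n (v : 'I_n -> R -> R[i]) : (forall i, csqint (v i)) ->
  csqint (fun t => \sum_(i < n) v i t).
Proof.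
elim: n v => [|n IH] v sv; first by under eq_fun do rewrite big_ord0; exact: csqint0.
by under eq_fun do rewrite big_ord_recl; apply: csqintD => //; exact: IH.
Qed.

Lemma dot_sumr u n (v : 'I_n -> R -> R[i]) : csqint u -> (forall i, csqint (v i)) ->
  dot u (fun t => \sum_(i < n) v i t) = \sum_(i < n) dot u (v i).
Proof.
move=> su; elim: n v => [|n IH] v sv.
  rewrite big_ord0 /dot (_ : (fun t => _) = fun=> 0) ?Rintegral_cst ?mul0r//.
  by apply/funext => t; rewrite big_ord0 /= !mulr0 addr0.
rewrite big_ord_recl -IH// -dotDr//; last exact: csqint_sum.
by congr dot; apply/funext => t; rewrite big_ord_recl.
Qed.

Lemma dot_laurent f p N : csqint (on_param f) ->
  dot (on_param f) (laurent p N) =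
  \sum_(i < size p) Re ((p`_i)^* * fourier f (i%:Z - N%:Z)).
Proof.
move=> sf.
rewrite (_ : laurent p N = fun t => \sum_(i < size p) p`_i * circ t ^ (i%:Z - N%:Z)).
  rewrite dot_sumr//.
    by apply: eq_bigr => i _; rewrite fourier_dot.
  by move=> i; exact/csqintZ/bounded_csqint/bounded_mfun_circXz.
apply/funext => t; rewrite /laurent horner_coef mulr_suml; apply: eq_bigr => i _.
by rewrite expfzDr ?circ_neq0// mulrA exprnN.
Qed.

(** Approximate [g] by a Laurent polynomial and split the latter into a polynomial [a]
    and a part [b] with negative exponents only. As [b] is orthogonal to [g - a],
    dropping it improves the approximation. As [f] is orthogonal to [a], the product
    of [f] and [g] equals that of [f] and [g - a], which is small. *)
Lemma H2bar0_orth_H2 f g : H2bar0 f -> H2 g -> dot (on_param f) (on_param g) = 0.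
Proof.
move=> [/L2P sf f0] [/L2P sg g0].
suff H e : 0 < e -> `|dot (on_param f) (on_param g)| <= l2norm (on_param f) * e.
  apply/eqP; rewrite -normr_le0 leNgt; apply/negP => d0.
  have n1 : 0 < l2norm (on_param f) + 1 by rewrite ltr_wpDl ?l2norm_ge0.
  have := H _ (divr_gt0 d0 n1).
  rewrite mulrCA ler_pMr// ler_pdivlMr//; lra.
move=> e0; have [p [N pe]] := trig_dense_csqint sg e0.
(* division by [X^N] separates the exponents at least [N], which become nonnegative *)
pose a : {poly R[i]} := p %/ 'X^N; pose b : {poly R[i]} := p %% 'X^N.
have bN : (size b <= N)%N.
  by rewrite -ltnS -(size_polyXn R[i] N) ltn_modp -size_poly_gt0 size_polyXn.
have pab t : laurent p N t = a.[circ t] + laurent b N t.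
  rewrite /laurent {1}(divp_eq p 'X^N) hornerD hornerM hornerXn mulrDl mulfK//.
  by rewrite expf_neq0// circ_neq0.
have sa := csqint_horner a; have sb := csqint_laurent b N.
have sga : csqint (on_param (fun z => g z - a.[z])) by exact: csqintB.
have gab : dot (on_param (fun z => g z - a.[z])) (laurent b N) = 0.
  rewrite dot_laurent// big1// => i _; rewrite fourierB//.
  have iN : i%:Z - N%:Z < 0 by rewrite subr_lt0 ltz_nat (leq_trans _ bN).
  by rewrite g0// fourier_horner leNgt iN subrr mulr0.
have gae : l2norm (on_param (fun z => g z - a.[z])) < e.
  apply: le_lt_trans pe.
  rewrite (_ : (fun t => g (circ t) - _) = fun t =>
     (on_param (fun z => g z - a.[z]) t - laurent b N t)); last first.
    by apply/funext => t; rewrite pab /on_param opprD addrA.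
  rewrite -ler_sqr ?nnegrE ?l2norm_ge0// !l2norm_sqr [leRHS]dotBl//; last exact: csqintB.
  rewrite [X in _ <= X - _]dotBr// [X in _ <= _ - X]dotBr//.
  rewrite (dotC (laurent b N)) gab.
  by have := dot_ge0 (laurent b N); lra.
have fa : dot (on_param f) (on_param (fun z => a.[z])) = 0.
  rewrite (_ : on_param (fun z => a.[z]) = laurent a 0).
    rewrite dot_laurent// big1// => i _.
    by rewrite f0 ?mulr0// subr0.
  by apply/funext => t; rewrite /laurent expr0 divr1.
have -> : dot (on_param f) (on_param g) =
    dot (on_param f) (on_param (fun z => g z - a.[z])).
  by rewrite dotBr// fa subr0.
apply: le_trans (normr_dot_le sf sga) _.
by rewrite ler_wpM2l ?l2norm_ge0// ltW.
Qed.

End Fourier.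

(** * Blaschke factors acting on the two Hardy spaces *)

Section Blaschke.
Context {R : realType}.
Implicit Types (f g v : R[i] -> R[i]) (p q : {poly R[i]}) (a c z : R[i]) (s rs : seq R[i]).

Lemma H2_ext f g : (forall t, f (circ t) = g (circ t)) -> H2 f -> H2 g.
Proof.
move=> fg [/L2P sf f0]; split; first by apply/L2P; rewrite -(on_param_ext fg).
by move=> k /f0; rewrite (fourier_ext _ fg).
Qed.

Lemma H2Z c f : H2 f -> H2 (fun z => c * f z).
Proof.
move=> [/L2P sf f0]; split; first by apply/L2P; exact: csqintZ.
by move=> k /f0 fk; rewrite fourierZ// fk mulr0.
Qed.

Lemma H2B f g : H2 f -> H2 g -> H2 (fun z => f z - g z).
Proof.
move=> [/L2P sf f0] [/L2P sg g0]; split; first by apply/L2P; exact: csqintB.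
by move=> k k0; rewrite fourierB// f0// g0// subrr.
Qed.

Lemma sub1_circ_lower a t : 1 - normc a <= normc (1 - a * circ t).
Proof.
have := le_normcD (1 - a * circ t) (a * circ t).
by rewrite subrK normcM normc_circ mulr1 [normc 1]normc1; lra.
Qed.

Lemma sub1_circ_neq0 a t : normc a < 1 -> 1 - a * circ t != 0.
Proof.
move=> a1; rewrite -normc_eq0 gt_eqF//.
by apply: lt_le_trans (sub1_circ_lower a t); rewrite subr_gt0.
Qed.

Lemma bounded_mfun_sub1 a : bounded_mfun (fun t : R => 1 - a * circ t).
Proof.
under eq_fun do rewrite -mulNr; apply: bounded_mfunD.
  exact: bounded_mfun_cst.
by apply: bounded_mfunM; [exact: bounded_mfun_cst|exact: bounded_mfun_circ].
Qed.

Lemma bounded_mfun_sub1V a : normc a < 1 -> bounded_mfun (fun t : R => (1 - a * circ t)^-1).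
Proof.
move=> a1; apply: (bounded_mfunV _ (sub1_circ_lower a)).
  by rewrite subr_gt0.
exact: bounded_mfun_sub1.
Qed.

Lemma csqint_sub1V a f : normc a < 1 -> csqint (on_param f) ->
  csqint (on_param (fun z => f z / (1 - a * z))).
Proof.
move=> a1 sf; rewrite /on_param; under eq_fun do rewrite mulrC.
exact: csqint_bndM (bounded_mfun_sub1V a1) sf.
Qed.

Lemma csqint_mulz f : csqint (on_param f) -> csqint (on_param (fun z => z * f z)).
Proof. by apply: csqint_bndM; exact: bounded_mfun_circ. Qed.

Lemma fourier_sub1M a f k : csqint (on_param f) ->
  fourier (fun z => (1 - a * z) * f z) k = fourier f k - a * fourier f (k - 1).
Proof.
move=> sf; have szf := csqint_mulz sf.
rewrite -fourierX -fourierZ// -fourierB//; last exact: csqintZ.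
by apply: fourier_ext => t; ring.
Qed.

Lemma fourier_sub1V a f k : normc a < 1 -> csqint (on_param f) ->
  fourier (fun z => f z / (1 - a * z)) k =
  fourier f k + a * fourier (fun z => f z / (1 - a * z)) (k - 1).
Proof.
move=> a1 sf; have sh := csqint_sub1V a1 sf.
have := fourier_sub1M a k sh.
rewrite (fourier_ext (g := f)); first by move=> ->; rewrite subrK.
by move=> t; rewrite mulrC divfK// sub1_circ_neq0.
Qed.

(** Let [h = f / (1 - a z)]. For [k < 0] the coefficients of [h] satisfy
    [h^(k) = a h^(k - 1)], hence [h^(k) = a ^ j h^(k - j)] for every [j]; they are bounded
    and [|a| < 1], so they vanish. *)
Lemma H2_sub1V a f : normc a < 1 -> H2 f -> H2 (fun z => f z / (1 - a * z)).
Proof.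
move=> a1 [/L2P sf f0]; have sh := csqint_sub1V a1 sf.
split; first exact/L2P.
move=> k k0; set h := fun z => _.
have hk j : fourier h k = a ^+ j * fourier h (k - j%:Z).
  elim: j => [|j IH]; first by rewrite expr0 mul1r subr0.
  have kj : k - j%:Z < 0 by rewrite subr_lt0 (lt_le_trans k0).
  rewrite IH {1}/h fourier_sub1V// -/h f0// add0r mulrA -exprSr.
  by rewrite -addrA -opprD -[j.+1]addn1.
have hb j : normc (fourier h k) <= normc a ^+ j * (2 * l2norm (on_param h)).
  rewrite (hk j) normcM.
  have -> : normc (a ^+ j) = normc a ^+ j.
    by elim: (j) => [|i IH]; rewrite ?normc1// !exprS normcM IH.
  by rewrite ler_wpM2l ?exprn_ge0 ?normc_ge0// normc_fourier_le.
have cv : normc a ^+ j * (2 * l2norm (on_param h)) @[j --> \oo] --> (0 : R).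
  rewrite -(mul0r (2 * l2norm (on_param h))); apply: cvgMr_tmp.
  by apply: cvg_expr; rewrite ger0_norm ?normc_ge0.
apply/eqP; rewrite -normc_eq0 eq_le normc_ge0 andbT leNgt; apply/negP => h0.
move/cvgrPdist_lt : cv => /(_ _ h0)[j _ /(_ j (leqnn j))].
rewrite /= sub0r normrN ger0_norm; last first.
  by rewrite !mulr_ge0 ?exprn_ge0 ?normc_ge0 ?l2norm_ge0.
by move=> /(le_lt_trans (hb j)); rewrite ltxx.
Qed.

(** [root_poly s] and [refl_prod s] are the numerator and the denominator of the Blaschke
    product with zeros [s]. *)
Definition root_poly s : {poly R[i]} := \prod_(a <- s) ('X - a%:P).

Definition refl_prod s z : R[i] := \prod_(a <- s) (1 - a^* * z).

Lemma root_poly_cons a s z :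
  (root_poly (a :: s)).[z] = (z - a) * (root_poly s).[z].
Proof. by rewrite /root_poly big_cons hornerM hornerXsubC. Qed.

Lemma refl_prod_cons a s z : refl_prod (a :: s) z = (1 - a^* * z) * refl_prod s z.
Proof. by rewrite /refl_prod big_cons. Qed.

Lemma blaschke_productE c s z : blaschke_product c s z =
  c * ((root_poly s).[z] / refl_prod s z).
Proof.
rewrite /blaschke_product /root_poly /refl_prod horner_prod -prodf_div.
by congr (_ * _); apply: eq_bigr => a _; rewrite hornerXsubC.
Qed.

Lemma normc_conj z : normc z^* = normc z.
Proof. by case: z => x y /=; rewrite sqrrN. Qed.

Lemma size_root_poly s : size (root_poly s) = (size s).+1.
Proof. exact: size_prod_XsubC. Qed.

Lemma refl_prod_neq0 s t : {in s, forall a, normc a < 1} ->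
  refl_prod s (circ t) != 0.
Proof.
move=> s1; rewrite prodf_seq_neq0; apply/allP => a /s1 a1 /=.
by rewrite sub1_circ_neq0// normc_conj.
Qed.

Lemma root_poly_circ_neq0 s t : {in s, forall a, normc a != 1} ->
  (root_poly s).[circ t] != 0.
Proof.
move=> s1; rewrite -[_ == 0]/(root _ _) root_prod_XsubC.
by apply/negP => /s1; rewrite normc_circ eqxx.
Qed.

Lemma normc_blaschke c s t : normc c = 1 -> {in s, forall a, normc a < 1} ->
  normc (blaschke_product c s (circ t)) = 1.
Proof.
move=> c1 s1; rewrite /blaschke_product normcM c1 mul1r.
elim: s s1 => [|a s IH] s1; first by rewrite big_nil; exact: normc1.
rewrite big_cons normcM IH ?mulr1; last by move=> b bs; apply: s1; rewrite inE bs orbT.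
have a1 : normc a^* < 1 by rewrite normc_conj s1// mem_head.
(* on the circle the inverse is the conjugate *)
have -> : 1 - a^* * circ t = circ t * (circ t - a)^*.
  rewrite rmorphB /= mulrBr [circ t * a^*]mulrC; congr (_ - _).
  by rewrite -[LHS](divff (circ_neq0 t)) circV.
rewrite normcM normcV normcM normc_conj normc_circ mul1r divff//.
rewrite normc_eq0 subr_eq0; apply/eqP => ta.
by move: a1; rewrite normc_conj -ta normc_circ ltxx.
Qed.

Lemma H2_refl_prodV s f : {in s, forall a, normc a < 1} -> H2 f ->
  H2 (fun z => f z / refl_prod s z).
Proof.
elim: s f => [|a s IH] f s1 Hf.
  by apply: H2_ext Hf => t; rewrite /refl_prod big_nil divr1.
have a1 : normc a^* < 1 by rewrite normc_conj s1// mem_head.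
have s1' : {in s, forall b, normc b < 1} by move=> b bs; apply: s1; rewrite inE bs orbT.
apply: H2_ext (IH _ s1' (H2_sub1V a1 Hf)) => t.
by rewrite /refl_prod big_cons invfM mulrA.
Qed.

Lemma fourier_inv_sub1 a : normc a < 1 ->
  fourier (fun z => (1 - a * z)^-1) 0 = 1.
Proof.
move=> a1.
have [_ H] : H2 (fun z => 1 / (1 - a * z)).
  apply: H2_sub1V => //; apply: H2_ext (horner_H2 1) => t.
  by rewrite hornerC.
rewrite (@fourier_ext _ _ (fun z => 1 / (1 - a * z))); last by move=> t; rewrite mul1r.
rewrite (fourier_sub1V _ a1 (bounded_csqint (bounded_mfun_cst 1))) fourier_cst eqxx.
by rewrite H ?mulr0 ?addr0.
Qed.

(** The constant [c] is chosen so that the coefficient of [v] of index 0 vanishes, which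
    is possible because [1 / (1 - a^* z)] has mean 1. The coefficients of positive index
    then vanish one after the other, since [v^(k) = a^* v^(k - 1)] for [k > 0]. *)
Lemma H2bar0_blaschke_factor f a : normc a < 1 -> H2bar0 f -> exists v c,
  H2bar0 v /\ forall t, (circ t - a) / (1 - a^* * circ t) * f (circ t) =
    v (circ t) + c / (1 - a^* * circ t).
Proof.
move=> a1 [/L2P sf f0]; have a1' : normc a^* < 1 by rewrite normc_conj.
pose g z := (z - a) * f z; pose c := fourier (fun z => g z / (1 - a^* * z)) 0.
have sz := csqint_mulz sf.
have sg : csqint (on_param g).
  rewrite /on_param /g; under eq_fun do rewrite mulrBl.
  by apply: csqintB => //; exact: csqintZ.
have s1 (d : R[i]) : csqint (on_param (fun=> d)) by exact/bounded_csqint/bounded_mfun_cst.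
have gk k : 0 < k -> fourier (fun z => g z - c) k = 0.
  move=> k0; rewrite fourierB// fourier_cst gt_eqF// subr0.
  rewrite (@fourier_ext _ _ (fun z => z * f z - a * f z)); last first.
    by move=> t; rewrite /g mulrBl.
  rewrite fourierB//; last exact: csqintZ.
  have k1 : 0 <= k - 1 by rewrite subr_ge0 -gtz0_ge1.
  by rewrite fourierX fourierZ// f0// f0 ?ltW// mulr0 subrr.
have sgc : csqint (on_param (fun z => g z - c)) by exact: (csqintB sg (s1 c)).
exists (fun z => (g z - c) / (1 - a^* * z)), c; split; last first.
  by move=> t; rewrite -mulrDl subrK mulrAC.
split; first by apply/L2P; exact: csqint_sub1V.
case=> // k _; elim: k => [|k IH].
  rewrite (@fourier_ext _ _ (fun z => g z / (1 - a^* * z) - c * (1 - a^* * z)^-1)); last first.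
    by move=> t; ring.
  have sV := bounded_csqint (bounded_mfun_sub1V a1').
  have sgV := csqint_sub1V a1' sg.
  rewrite fourierB//; last exact: (csqintZ c sV).
  rewrite fourierZ//.
  by rewrite [X in _ - _ * X](fourier_inv_sub1 a1') mulr1 subrr.
rewrite fourier_sub1V// gk// add0r.
by rewrite (_ : k.+1%:Z - 1 = k%:Z) ?IH ?mulr0// intS addrC addKr.
Qed.

(** Multiplying [f] by a Blaschke product with [k] zeros only creates an analytic part
    that is rational, with denominator [refl_prod s] and numerator of degree less than [k].
    This is why the best approximants of [f] in [H2n] are rational. *)
Lemma H2bar0_blaschke f s : {in s, forall a, normc a < 1} -> H2bar0 f ->
  exists v p, [/\ H2bar0 v, (size p <= size s)%N & forall t,
    (root_poly s).[circ t] / refl_prod s (circ t) * f (circ t) =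
    v (circ t) + p.[circ t] / refl_prod s (circ t)].
Proof.
elim: s f => [|a s IH] f s1 Hf.
  exists f, 0; split=> [//||t]; first by rewrite size_poly0.
  by rewrite /root_poly /refl_prod !big_nil hornerC horner0 divr1 mul1r mul0r addr0.
have a1 : normc a < 1 by rewrite s1// mem_head.
have s1' : {in s, forall b, normc b < 1} by move=> b bs; apply: s1; rewrite inE bs orbT.
have [v [c [Hv vE]]] := H2bar0_blaschke_factor a1 Hf.
have [v' [p [Hv' ps pE]]] := IH v s1' Hv.
pose d : {poly R[i]} := 1 - (a^*)%:P * 'X.
exists v', (p * d + c *: root_poly s); split=> //.
  apply: leq_trans (size_polyD _ _) _; rewrite geq_max; apply/andP; split.
    apply: leq_trans (size_polyMleq _ _) _.
    have d2 : (size d <= 2)%N.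
      apply: leq_trans (size_polyD _ _) _; rewrite geq_max size_poly1 size_polyN /=.
      by rewrite mul_polyC; apply: leq_trans (size_scale_leq _ _) _; rewrite size_polyX.
    by rewrite -subn1 leq_subLR add1n (leq_trans (leq_add ps d2))// addn2.
  by apply: leq_trans (size_scale_leq _ _) _; rewrite size_root_poly.
move=> t; have a1' : normc a^* < 1 by rewrite normc_conj.
have n1 := sub1_circ_neq0 t a1'; have n2 := refl_prod_neq0 t s1'.
have -> : (root_poly (a :: s)).[circ t] / refl_prod (a :: s) (circ t) * f (circ t)
  = (root_poly s).[circ t] / refl_prod s (circ t) *
    ((circ t - a) / (1 - a^* * circ t) * f (circ t)).
  rewrite root_poly_cons refl_prod_cons.
  by field; rewrite n1 n2.
rewrite vE mulrDr pE refl_prod_cons hornerD hornerM hornerZ.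
have -> : d.[circ t] = 1 - a^* * circ t by rewrite /d hornerD hornerN hornerM !hornerE.
by field; rewrite n1 n2.
Qed.

End Blaschke.

(** * Rational approximation and meromorphic approximation *)

Section Distances.
Context {R : realType}.
Implicit Types (f g v : R[i] -> R[i]) (p q : {poly R[i]}) (a c z : R[i]) (s rs : seq R[i]).

Lemma Lpnorm_ext r f g : (forall t, normc (f (circ t)) = normc (g (circ t))) ->
  Lpnorm r f = Lpnorm r g.
Proof. by move=> fg; rewrite /Lpnorm; apply: eq_Lnorm => t; rewrite fg. Qed.

Lemma le_d2 f (E F : set (R[i] -> R[i])) :
  (forall h, F h -> exists2 h', E h' &
     (Lpnorm 2%:E (fun z => (f z - h' z)%R) <= Lpnorm 2%:E (fun z => (f z - h z)%R))%E) ->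
  (d2 f E <= d2 f F)%E.
Proof.
move=> FE; apply: le_ereal_inf_tmp => _ [h /FE[h' Eh' le_h] <-].
by apply: le_trans le_h; apply: ereal_inf_lbound; exists h'.
Qed.

(** The roots inside the disk are reflected across the circle by the Blaschke product,
    and both kinds of factors that remain in the denominator have their root outside. *)
Lemma H2_blaschke_div rs v : {in rs, forall r, normc r != 1} -> H2 v ->
  let s := [seq r <- rs | normc r < 1] in
  H2 (fun z => (root_poly s).[z] / refl_prod s z * (v z / (root_poly rs).[z])).
Proof.
elim: rs v => [|r rs IH] v rs1 Hv /=.
  apply: H2_ext Hv => t.
  by rewrite /root_poly /refl_prod !big_nil hornerC !divr1 mul1r.
have r1 : normc r != 1 by rewrite rs1// mem_head.
have rs1' : {in rs, forall r, normc r != 1} by move=> b bs; apply: rs1; rewrite inE bs orbT.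
have n1 t : circ t - r != 0.
  by rewrite subr_eq0; apply: contraNneq r1 => <-; rewrite normc_circ.
have n2 t := root_poly_circ_neq0 t rs1'.
have s1 : {in [seq r <- rs | normc r < 1], forall a, normc a < 1}.
  by move=> a; rewrite mem_filter => /andP[].
have n3 t := refl_prod_neq0 t s1.
have [r_lt1|r_ge1] := ltP (normc r) 1.
  have rb : normc r^* < 1 by rewrite normc_conj.
  apply: H2_ext (IH _ rs1' (H2_sub1V rb Hv)) => t.
  rewrite !root_poly_cons refl_prod_cons.
  by field; rewrite n1 n2 n3 sub1_circ_neq0.
have r_gt1 : 1 < normc r by rewrite lt_neqAle eq_sym r1.
have r0 : r != 0 by rewrite -normc_eq0 gt_eqF// (lt_trans ltr01).
have rV : normc r^-1 < 1 by rewrite normcV invf_lt1// (lt_trans ltr01).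
apply: H2_ext (IH _ rs1' (H2Z (- r^-1) (H2_sub1V rV Hv))) => t.
have -> : 1 - r^-1 * circ t = - r^-1 * (circ t - r) by field.
rewrite root_poly_cons.
by field; rewrite n1 n2 n3 r0.
Qed.

(** Dividing by the Blaschke product of the roots of the denominator that lie in the
    disk produces the poles of [h] there. *)
Lemma ratfun_H2n m n h : ratfun m n h ->
  exists2 h', H2n n h' & forall t : R, h (circ t) = h' (circ t).
Proof.
move=> [p [q [_ qn q1 ->]]].
have q0 : q != 0.
  apply: contraTneq (q1 1 _) => [->|]; first by rewrite root0.
  exact: normc1.
have [rs def_q] := closed_field_poly_normal q; rewrite -/(root_poly rs) in def_q.
have lq0 : lead_coef q != 0 by rewrite lead_coef_eq0.
have rs1 : {in rs, forall r, normc r != 1}.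
  move=> r rrs; apply/eqP => /q1/negP; apply.
  by rewrite def_q rootZ// root_prod_XsubC.
pose s := [seq r <- rs | normc r < 1].
have s1 : {in s, forall a, normc a < 1} by move=> a; rewrite mem_filter => /andP[].
have Hg := H2_blaschke_div rs1 (H2Z (lead_coef q)^-1 (horner_H2 p)).
exists (fun z => ((root_poly s).[z] / refl_prod s z *
    ((lead_coef q)^-1 * p.[z] / (root_poly rs).[z])) / blaschke_product 1 s z).
  exists (fun z => (root_poly s).[z] / refl_prod s z *
    ((lead_coef q)^-1 * p.[z] / (root_poly rs).[z])), (blaschke_product 1 s).
  split=> //; exists 1, s; split=> //; first exact: normc1.
  rewrite (@leq_trans (size rs)) ?size_filter ?count_size//.
  move: qn; rewrite /poly_le /= def_q size_scale// size_root_poly.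
  by [].
move=> t; rewrite blaschke_productE mul1r.
have n1 : (root_poly s).[circ t] != 0.
  by apply: root_poly_circ_neq0 => a /s1; rewrite lt_neqAle => /andP[].
have n2 := refl_prod_neq0 t s1; have n3 := root_poly_circ_neq0 t rs1.
rewrite [in LHS]def_q hornerZ.
by field; rewrite n1 n2 n3 lq0.
Qed.

Lemma l2norm_orth_le v g : H2bar0 v -> H2 g ->
  l2norm (on_param v) <= l2norm (on_param (fun z => v z + g z)).
Proof.
move=> Hv Hg; have [/L2P sv _] := Hv; have [/L2P sg _] := Hg.
have svg : csqint (on_param (fun z => v z + g z)) by exact: csqintD.
rewrite -ler_sqr ?nnegrE ?l2norm_ge0// !l2norm_sqr [leRHS]dotDl// [X in _ <= X + _]dotDr//.
rewrite [X in _ <= _ + X]dotDr// (dotC (on_param g)) (H2bar0_orth_H2 Hv Hg).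
by have := dot_ge0 (on_param g); lra.
Qed.

(** With [h = g / b] and [b f = v + r], where [v] is in [H2bar0] and [r] is analytic and
    rational, the error of [g / b] is that of [v + (r - g)], because [b] is unimodular. By
    orthogonality it is at least the norm of [v], which is the error of [r / b]. *)
Lemma H2n_ratfun n f h : (1 <= n)%N -> H2bar0 f -> H2n n h ->
  exists2 h', ratfun n.-1 n h' &
    (Lpnorm 2%:E (fun z => (f z - h' z)%R) <= Lpnorm 2%:E (fun z => (f z - h z)%R))%E.
Proof.
move=> n1 Hf [g [b [Hg [c [s [c1 sn s1 ->]] ->]]]].
have [v [p [Hv ps pE]]] := H2bar0_blaschke s1 Hf.
have s1' : {in s, forall a, normc a != 1} by move=> a /s1; rewrite lt_neqAle => /andP[].
exists (fun z => p.[z] / (root_poly s).[z]).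
  exists p, (root_poly s); split=> //.
  - by rewrite /poly_le /= prednK// (leq_trans ps).
  - by rewrite /poly_le /= size_root_poly.
  - move=> z z1; rewrite root_prod_XsubC; apply/negP => /s1'.
    by rewrite z1 eqxx.
have c0 : c != 0 by rewrite -normc_eq0 c1 oner_eq0.
pose w z := p.[z] / refl_prod s z - c^-1 * g z.
have Hw : H2 w.
  by apply: H2B; [exact/H2_refl_prodV/horner_H2|exact: H2Z].
have bs t := normc_blaschke t c1 s1.
have n2 t := refl_prod_neq0 t s1; have n3 t := root_poly_circ_neq0 t s1'.
have [/L2P sv _] := Hv; have [/L2P sw _] := Hw.
have svw : csqint (on_param (fun z => v z + w z)) by exact: csqintD.
have -> : Lpnorm 2%:E (fun z => f z - p.[z] / (root_poly s).[z]) = Lpnorm 2%:E v.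
  apply: Lpnorm_ext => t.
  have vt : c * v (circ t) =
      blaschke_product c s (circ t) * (f (circ t) - p.[circ t] / (root_poly s).[circ t]).
    have -> : v (circ t) = (root_poly s).[circ t] / refl_prod s (circ t) * f (circ t) -
        p.[circ t] / refl_prod s (circ t) by rewrite pE addrK.
    by rewrite blaschke_productE; field; rewrite n2 n3.
  by rewrite -[RHS]mul1r -c1 -normcM vt normcM bs mul1r.
have -> : Lpnorm 2%:E (fun z => f z - g z / blaschke_product c s z) =
    Lpnorm 2%:E (fun z => v z + w z).
  apply: Lpnorm_ext => t.
  have vt : c * (v (circ t) + w (circ t)) =
      blaschke_product c s (circ t) * (f (circ t) - g (circ t) / blaschke_product c s (circ t)).
    have -> : v (circ t) = (root_poly s).[circ t] / refl_prod s (circ t) * f (circ t) -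
        p.[circ t] / refl_prod s (circ t) by rewrite pE addrK.
    by rewrite blaschke_productE /w; field; rewrite n2 n3 c0.
  by rewrite -[RHS]mul1r -c1 -normcM vt normcM bs mul1r.
by rewrite !Lpnorm2E// lee_fin l2norm_orth_le.
Qed.

Lemma d2_ratfun_H2n n f : (1 <= n)%N -> H2bar0 f ->
  d2 f (ratfun n.-1 n) = d2 f (H2n n).
Proof.
move=> n1 Hf; apply/le_anti/andP; split; apply: le_d2 => h.
  exact: H2n_ratfun.
move=> /ratfun_H2n[h' Hh' hh']; exists h' => //.
by rewrite le_eqVlt; apply/orP; left; apply/eqP; apply: Lpnorm_ext => t; rewrite hh'.
Qed.

End Distances.

(** * Minimizing a seminorm on the unit sphere of another one *)

Section Seminorms.
Context {R : realType} {m : nat}.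
Implicit Types (F G : 'rV[R]_m -> R) (x y : 'rV[R]_m).

Definition seminorm F := (forall x y, F (x + y) <= F x + F y) /\
  (forall k x, F (k *: x) = `|k| * F x).

Lemma seminorm0 F : seminorm F -> F 0 = 0.
Proof. by move=> [_ FZ]; rewrite -(scale0r 0) FZ normr0 mul0r. Qed.

Lemma seminormN F x : seminorm F -> F (- x) = F x.
Proof. by move=> [_ FZ]; rewrite -scaleN1r FZ normrN1 mul1r. Qed.

Lemma seminorm_ge0 F x : seminorm F -> 0 <= F x.
Proof.
move=> sF; have [FD _] := sF.
by have := FD x (- x); rewrite subrr seminorm0// seminormN//; lra.
Qed.

Lemma seminorm_dist F x y : seminorm F -> `|F x - F y| <= F (x - y).
Proof.
move=> sF; have [FD _] := sF.
have := FD (x - y) y; rewrite subrK => h1.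
have := FD (y - x) x; rewrite subrK -opprB seminormN// => h2.
by rewrite ler_norml; apply/andP; split; lra.
Qed.

Lemma seminorm_sum F n (v : 'I_n -> 'rV[R]_m) : seminorm F ->
  F (\sum_(i < n) v i) <= \sum_(i < n) F (v i).
Proof.
move=> sF; elim: n v => [|n IH] v; first by rewrite !big_ord0 seminorm0.
rewrite !big_ord_recl; have [FD _] := sF.
by apply: le_trans (FD _ _) _; rewrite lerD2l.
Qed.

(** A seminorm is Lipschitz, its values being controlled by those at the unit vectors. *)
Lemma seminorm_continuous F : seminorm F -> continuous F.
Proof.
move=> sF x; apply/(@cvgrPdist_lt _ _ _ (nbhs x) (nbhs_filter x)) => e e0.
pose K := \sum_(i < m) F (delta_mx 0 i).
have K0 : 0 <= K by apply: sumr_ge0 => i _; exact: seminorm_ge0.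
have FK v : F v <= `|v| * K.
  rewrite {1}(row_sum_delta v); apply: le_trans (seminorm_sum _ sF) _.
  rewrite mulr_sumr; apply: ler_sum => i _.
  have [_ ->] := sF; rewrite ler_wpM2r ?seminorm_ge0//.
  rewrite [leRHS]/Num.norm /= mx_normrE.
  by apply/bigmax_geP; right => /=; exists (0, i).
have K1 : 0 < K + 1 by rewrite ltr_wpDl.
apply/nbhs_ballP; exists (e / (K + 1)); first exact: divr_gt0.
move=> y; rewrite -ball_normE /= ltr_pdivlMr// => xy.
apply: le_lt_trans (seminorm_dist _ _ sF) _; apply: le_lt_trans (FK _) _.
by apply: le_lt_trans xy; rewrite ler_wpM2l// lerDl.
Qed.

(** By coercivity the points of the sphere [G = 1] where [F] does not exceed its value
    at a given point of that sphere form a compact set. *)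
Lemma seminorm_min F G (C : R) : seminorm F -> seminorm G ->
  (forall x i, `|x 0 i| <= C * (G x + F x)) -> (exists x, G x = 1) ->
  exists x, G x = 1 /\ forall y, G y = 1 -> F x <= F y.
Proof.
move=> sF sG coer [x0 Gx0].
have cF := seminorm_continuous sF; have cG := seminorm_continuous sG.
pose M := F x0; pose A := [set x | G x = 1] `&` [set x | F x <= M].
have Acl : closed A.
  apply: closedI.
    apply: (closed_comp (f := G) (D := [set 1])) => [x _|]; first exact: cG.
    exact: closed_eq.
  apply: (closed_comp (f := F) (D := [set r | r <= M])) => [x _|]; first exact: cF.
  exact: closed_le.
have C0 (x : 'rV[R]_m) (i : 'I_m) : G x = 1 -> F x <= M -> `|x 0 i| <= `|C| * (1 + M).
  move=> Gx Fx; apply: le_trans (coer x i) _; rewrite Gx.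
  have F0 := seminorm_ge0 x sF.
  apply: (@le_trans _ _ (`|C| * (1 + F x))).
    by rewrite ler_wpM2r ?ler_norm// addr_ge0.
  by rewrite ler_wpM2l// lerD2l.
have Aco : compact A.
  pose L := `|C| * (1 + M).
  have box := @rV_compact _ m (fun=> `[- L, L]%classic) (fun=> @segment_compact _ _ _).
  apply: subclosed_compact Acl box _ => x [Gx Fx] i /=.
  by rewrite in_itv /= -ler_norml; exact: C0.
have A0 : A !=set0 by exists x0; split => //=.
have [x /set_mem[Gx Fx] xmin] := compact_EVT_min A0 Aco (continuous_subspaceT cF).
exists x; split=> // y Gy; have [yM|My] := leP (F y) M.
  by apply: xmin; rewrite inE.
exact: le_trans Fx (ltW My).
Qed.

End Seminorms.

(** * The essential supremum on the circle *)

Section SupNorm.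
Context {R : realType}.
Local Notation mu := (@arclength R).
Implicit Types (f g : R[i] -> R[i]) (p q w : {poly R[i]}).

Definition supnorm f : R := fine (Lpnorm +oo%E f).

Lemma Lpnorm_yE f : Lpnorm +oo%E f = ess_sup mu (fun t => (normc (f (circ t)))%:E).
Proof.
rewrite /Lpnorm unlock [X in (_ < X)%E](_ : _ = 1%E) ?lte01//; last exact: probability_setT.
congr ess_sup.
by apply/funext => t /=; rewrite ger0_norm ?normc_ge0.
Qed.

Lemma supnorm_ge0 f : 0 <= supnorm f.
Proof. by apply: fine_ge0; exact: Lnorm_ge0. Qed.

Lemma Lpnorm_yK f : bounded_mfun (on_param f) -> Lpnorm +oo%E f = (supnorm f)%:E.
Proof.
move=> [_ _ [C fC]]; rewrite /supnorm fineK// ge0_fin_numE; last exact: Lnorm_ge0.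
rewrite Lpnorm_yE; apply: (@le_lt_trans _ _ C%:E); last exact: ltry.
by apply/ess_supP/nearW => t; rewrite lee_fin; exact: fC.
Qed.

Lemma ae_le_supnorm f : bounded_mfun (on_param f) ->
  {ae mu, forall t, normc (f (circ t)) <= supnorm f}.
Proof.
move=> bf; have := ess_sup_ge mu (fun t => (normc (f (circ t)))%:E).
by rewrite -Lpnorm_yE Lpnorm_yK//; apply: filterS => t; rewrite lee_fin.
Qed.

Lemma supnorm_le f (C : R) : bounded_mfun (on_param f) ->
  {ae mu, forall t, normc (f (circ t)) <= C} -> supnorm f <= C.
Proof.
move=> bf fC; rewrite -lee_fin -Lpnorm_yK// Lpnorm_yE.
by apply/ess_supP; apply: filterS fC => t; rewrite lee_fin.
Qed.

Lemma supnormD f g : bounded_mfun (on_param f) -> bounded_mfun (on_param g) ->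
  supnorm (fun z => f z + g z) <= supnorm f + supnorm g.
Proof.
move=> bf bg; apply: supnorm_le; first exact: bounded_mfunD.
apply: filterS (filterI (ae_le_supnorm bf) (ae_le_supnorm bg)) => t [ft gt].
exact: le_trans (le_normcD _ _) (lerD ft gt).
Qed.

Lemma supnormZ_le (c : R[i]) f : bounded_mfun (on_param f) ->
  supnorm (fun z => c * f z) <= normc c * supnorm f.
Proof.
move=> bf; apply: supnorm_le; first by apply: bounded_mfunM => //; exact: bounded_mfun_cst.
apply: filterS (ae_le_supnorm bf) => t ft.
by rewrite normcM ler_wpM2l ?normc_ge0.
Qed.

(** For a nonzero scalar the reverse inequality is [supnormZ_le] for its inverse. *)
Lemma supnormZ (c : R[i]) f : bounded_mfun (on_param f) ->
  supnorm (fun z => c * f z) = normc c * supnorm f.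
Proof.
move=> bf; have [->|c0] := eqVneq c 0.
  rewrite normc0 mul0r; apply/le_anti; rewrite supnorm_ge0 andbT.
  by have := supnormZ_le 0 bf; rewrite normc0 mul0r.
apply/le_anti; rewrite supnormZ_le//=.
have bcf : bounded_mfun (on_param (fun z => c * f z)).
  by apply: bounded_mfunM => //; exact: bounded_mfun_cst.
have nc : 0 < normc c by rewrite lt_neqAle eq_sym normc_eq0 c0 normc_ge0.
rewrite mulrC -ler_pdivlMr// mulrC -normcV.
have := supnormZ_le c^-1 bcf; congr (_ <= _); rewrite /supnorm; congr fine.
by apply: Lpnorm_ext => t; rewrite mulKf.
Qed.

Lemma l2normM_le f g : bounded_mfun (on_param f) -> csqint (on_param g) ->
  l2norm (on_param (fun z => f z * g z)) <= supnorm f * l2norm (on_param g).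
Proof.
move=> bf sg; have sfg : csqint (on_param (fun z => f z * g z)) by exact: csqint_bndM.
rewrite -ler_sqr ?nnegrE ?mulr_ge0 ?l2norm_ge0 ?supnorm_ge0// exprMn !l2norm_sqr !dotuu.
have ig := l2norm_int sg; have ifg := l2norm_int sfg.
rewrite -RintegralZl// /Rintegral fine_le//.
- exact: integrable_fin_num.
- by apply: integrable_fin_num => //; exact: integrable_EFinZ.
apply: ae_ge0_le_integral => //.
- by move=> t _; rewrite lee_fin sqr_ge0.
- by case/integrableP: ifg.
- by move=> t _; rewrite lee_fin mulr_ge0 ?sqr_ge0.
- by case/integrableP: (integrable_EFinZ (supnorm f ^+ 2) ig).
- apply: filterS (ae_le_supnorm bf) => t ft _; rewrite lee_fin /on_param normcM exprMn.
  by rewrite ler_wpM2r ?sqr_ge0// ler_sqr ?nnegrE ?normc_ge0 ?supnorm_ge0.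
Qed.

Lemma l2norm_le_supnorm f : bounded_mfun (on_param f) -> l2norm (on_param f) <= supnorm f.
Proof.
move=> bf; have s1 : csqint (on_param (fun=> 1 : R[i])) by exact/bounded_csqint/bounded_mfun_cst.
have := l2normM_le bf s1.
rewrite (@l2norm_unimodular _ (on_param (fun=> 1))) ?mulr1; last first.
  by move=> t; exact: normc1.
by congr (l2norm _ <= _); apply/funext => t; rewrite /on_param mulr1.
Qed.

End SupNorm.

(** * Real coordinates for complex polynomials *)

Section Coordinates.
Context {R : realType}.

(** The coordinates are real because the existence of the minimum rests on compactness
    in a real space. *)
Definition cpoly d (x : 'rV[R]_(d + d)) : {poly R[i]} :=
  rVpoly (\row_(j < d) (lsubmx x 0 j +i* rsubmx x 0 j)).

Lemma size_cpoly d (x : 'rV[R]_(d + d)) : (size (cpoly x) <= d)%N.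
Proof. exact: size_poly. Qed.

Lemma coef_cpoly d (x : 'rV[R]_(d + d)) (j : 'I_d) :
  (cpoly x)`_j = x 0 (lshift d j) +i* x 0 (rshift d j).
Proof. by rewrite /cpoly coef_rVpoly_ord !mxE. Qed.

Lemma cpolyD d (x y : 'rV[R]_(d + d)) : cpoly (x + y) = cpoly x + cpoly y.
Proof.
by rewrite /cpoly -linearD /=; congr rVpoly; apply/rowP => j; rewrite !mxE.
Qed.

Lemma cpolyZ d (k : R) (x : 'rV[R]_(d + d)) : cpoly (k *: x) = k%:C *: cpoly x.
Proof.
rewrite /cpoly -linearZ /=; congr rVpoly; apply/rowP => j; rewrite !mxE.
by apply/eqP; rewrite eq_complex /= !mul0r subr0 addr0 !eqxx.
Qed.

Lemma cpoly_surj d (p : {poly R[i]}) : (size p <= d)%N -> exists x : 'rV[R]_(d + d), cpoly x = p.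
Proof.
move=> pd; exists (row_mx (\row_j Re p`_j) (\row_j Im p`_j)).
rewrite -[RHS](poly_rV_K pd) /cpoly; congr rVpoly; apply/rowP => j.
by rewrite row_mxKl row_mxKr !mxE; case: (p`_j).
Qed.

Lemma cpoly_coord_le d (x : 'rV[R]_(d + d)) (C : R) :
  (forall j, normc (cpoly x)`_j <= C) -> forall i, `|x 0 i| <= C.
Proof.
move=> xC i; have [j ->|j ->] := split_ordP i.
  by apply: le_trans (xC j); rewrite coef_cpoly; exact: (normRe_le (_ +i* _)).
by apply: le_trans (xC j); rewrite coef_cpoly; exact: (normIm_le (_ +i* _)).
Qed.

End Coordinates.

(** * The linearized error *)

Section LinearizedError.
Context {R : realType}.
Variables (f : R[i] -> R[i]) (w : {poly R[i]}).
Hypotheses (sf : csqint (on_param f)) (w1 : no_zero_on_circle w).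
Implicit Types (p q : {poly R[i]}).

Definition linearized_error q p : R[i] -> R[i] := fun z => (q.[z] * f z - p.[z]) / w.[z].

Definition weighted q : R[i] -> R[i] := fun z => q.[z] / w.[z].

Lemma w_neq0 t : w.[circ t] != 0.
Proof. by apply: w1; exact: normc_circ. Qed.

Lemma bounded_weighted q : bounded_mfun (on_param (weighted q)).
Proof. by apply: bounded_mfunM; [exact: bounded_mfun_horner|exact: bounded_mfun_hornerV]. Qed.

Lemma linearized_errorE q p t : linearized_error q p (circ t) =
  weighted q (circ t) * f (circ t) - weighted p (circ t).
Proof. by rewrite /linearized_error /weighted mulrBl mulrAC. Qed.

Lemma csqint_linearized_error q p : csqint (on_param (linearized_error q p)).
Proof.
rewrite /on_param (funext (linearized_errorE q p)).
apply: csqintB; first exact: csqint_bndM (bounded_weighted q) sf.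
exact/bounded_csqint/bounded_weighted.
Qed.

(** The coefficients of [q = w (q / w)] are Fourier coefficients. *)
Lemma normc_coef_le q j :
  normc q`_j <= 2 * (supnorm (horner w) * l2norm (on_param (weighted q))).
Proof.
have := fourier_horner q j; rewrite /= => <-.
apply: le_trans (normc_fourier_le _ (csqint_horner q)) _; rewrite ler_wpM2l//.
have := l2normM_le (bounded_mfun_horner w) (bounded_csqint (bounded_weighted q)).
congr (l2norm _ <= _); apply/funext => t.
by rewrite /on_param /weighted mulrC divfK// w_neq0.
Qed.

Lemma supnorm_weighted_gt0 q : q != 0 -> 0 < supnorm (weighted q).
Proof.
move=> q0; rewrite lt_neqAle supnorm_ge0 andbT eq_sym; apply: contraNneq q0 => Nq.
rewrite -lead_coef_eq0 -normc_eq0; apply/eqP/le_anti; rewrite normc_ge0 andbT.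
apply: le_trans (normc_coef_le _ _) _.
have := l2norm_le_supnorm (bounded_weighted q); rewrite Nq => N0.
by rewrite (@le_anti _ _ (l2norm _) 0) ?mulr0// N0 l2norm_ge0.
Qed.

Lemma supnorm_weightedZ (c : R[i]) q : supnorm (weighted (c *: q)) = normc c * supnorm (weighted q).
Proof.
rewrite -supnormZ; last exact: bounded_weighted.
by congr fine; apply: Lpnorm_ext => t; rewrite /weighted hornerZ mulrA.
Qed.

Variables (d e : nat).
Local Notation V := 'rV[R]_((d + d) + (e + e)).

Let Q (x : V) := cpoly (lsubmx x).
Let P (x : V) := cpoly (rsubmx x).

Lemma seminorm_supnorm : seminorm (fun x : V => supnorm (weighted (Q x))).
Proof.
split=> [x y|k x].
  apply: le_trans (supnormD (bounded_weighted _) (bounded_weighted _)).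
  rewrite le_eqVlt; apply/orP; left; apply/eqP; congr fine; apply: Lpnorm_ext => t.
  by rewrite /Q linearD cpolyD /weighted hornerD mulrDl.
by rewrite /Q linearZ cpolyZ supnorm_weightedZ /= expr0n /= addr0 sqrtr_sqr.
Qed.

Lemma seminorm_l2norm : seminorm (fun x : V => l2norm (on_param (linearized_error (Q x) (P x)))).
Proof.
split=> [x y|k x].
  apply: le_trans (l2normD (csqint_linearized_error _ _) (csqint_linearized_error _ _)).
  rewrite le_eqVlt; apply/orP; left; apply/eqP; congr l2norm; apply/funext => t.
  rewrite /Q /P !linearD !cpolyD /on_param /linearized_error !hornerD -mulrDl.
  by congr (_ / _); ring.
have -> : `|k| = normc k%:C by rewrite /= expr0n /= addr0 sqrtr_sqr.
rewrite -l2normZ; last exact: csqint_linearized_error.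
congr l2norm; apply/funext => t.
rewrite /Q /P !linearZ !cpolyZ /on_param /linearized_error !hornerZ mulrA.
by congr (_ / _); ring.
Qed.

(** [q / w] is controlled by its supremum norm, and [p / w] is the difference of
    [(q / w) f] and the linearized error; both control the coefficients through
    [normc_coef_le]. *)
Lemma linearized_coercive (x : V) i : `|x 0 i| <=
  2 * supnorm (horner w) * (1 + l2norm (on_param f)) *
  (supnorm (weighted (Q x)) + l2norm (on_param (linearized_error (Q x) (P x)))).
Proof.
set W := supnorm (horner w); set G := supnorm _; set F := l2norm (on_param (linearized_error _ _)).
have W0 : 0 <= W by exact: supnorm_ge0.
have G0 : 0 <= G by exact: supnorm_ge0.
have F0 : 0 <= F by exact: l2norm_ge0.
have f0 : 0 <= l2norm (on_param f) by exact: l2norm_ge0.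
have f0G : 0 <= l2norm (on_param f) * G by exact: mulr_ge0.
have f0F : 0 <= l2norm (on_param f) * F by exact: mulr_ge0.
have [j ->|j ->] := split_ordP i.
  have -> : x 0 (lshift (e + e) j) = lsubmx x 0 j by rewrite mxE.
  apply: cpoly_coord_le j => j; apply: le_trans (normc_coef_le _ _) _.
  rewrite [leLHS]mulrA -[leRHS]mulrA ler_wpM2l ?mulr_ge0//.
  by have := l2norm_le_supnorm (bounded_weighted (Q x)); rewrite -/G; lra.
have -> : x 0 (rshift (d + d) j) = rsubmx x 0 j by rewrite mxE.
apply: cpoly_coord_le j => j; apply: le_trans (normc_coef_le _ _) _.
rewrite [leLHS]mulrA -[leRHS]mulrA ler_wpM2l ?mulr_ge0//.
have sQ := csqint_bndM (bounded_weighted (Q x)) sf.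
have sE := csqintZ (-1) (csqint_linearized_error (Q x) (P x)).
have := l2normD sQ sE; rewrite l2normZ; last exact: csqint_linearized_error.
have -> : normc (-1 : R[i]) = 1 by rewrite cnormN; exact: normc1.
rewrite mul1r -/F.
rewrite (_ : (fun t => _) = on_param (weighted (P x))); last first.
  by apply/funext => t; rewrite /on_param linearized_errorE mulN1r opprB addrCA subrr addr0.
by have := l2normM_le (bounded_weighted (Q x)) sf; rewrite -/G; lra.
Qed.

Lemma linearized_min : (0 < d)%N -> exists q p,
  [/\ (size q <= d)%N, (size p <= e)%N, supnorm (weighted q) = 1 &
   forall q' p', (size q' <= d)%N -> (size p' <= e)%N -> supnorm (weighted q') = 1 ->
     l2norm (on_param (linearized_error q p)) <= l2norm (on_param (linearized_error q' p'))].
Proof.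
move=> d0.
have coord (q p : {poly R[i]}) : (size q <= d)%N -> (size p <= e)%N ->
    exists x : V, Q x = q /\ P x = p.
  move=> /cpoly_surj[y yq] /cpoly_surj[z zp]; exists (row_mx y z).
  by rewrite /Q /P row_mxKl row_mxKr.
have [|x [x1 xmin]] := seminorm_min seminorm_l2norm seminorm_supnorm linearized_coercive.
  have N1 := supnorm_weighted_gt0 (oner_neq0 {poly R[i]}).
  pose c := supnorm (weighted 1).
  have [||x [xq _]] := coord (c^-1%:C *: 1) 0; last 1 first.
  - exists x; rewrite xq supnorm_weightedZ /= expr0n /= addr0 sqrtr_sqr.
    by rewrite ger0_norm ?invr_ge0 ?supnorm_ge0// mulVf// gt_eqF.
  - by rewrite (leq_trans (size_scale_leq _ _))// size_poly1.
  - by rewrite size_poly0.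
exists (Q x), (P x); split; [exact: size_cpoly|exact: size_cpoly|exact: x1|].
move=> q' p' size_q' sp' Nq'; have [y [yq yp]] := coord _ _ size_q' sp'.
by have := xmin y; rewrite yq yp; apply.
Qed.

(** On the circle the linearized error is the error of [p / q] multiplied by [q / w],
    whose supremum norm is 1. *)
Lemma linearized_le_error q p : no_zero_on_circle q -> supnorm (weighted q) = 1 ->
  ((l2norm (on_param (linearized_error q p)))%:E <=
   Lpnorm 2%:E (fun z => (f z - p.[z] / q.[z])%R))%E.
Proof.
move=> q1 Nq; have q0 t : q.[circ t] != 0 by apply: q1; exact: normc_circ.
have sh : csqint (on_param (fun z => f z - p.[z] / q.[z])).
  apply: csqintB => //; apply: bounded_csqint.
  by apply: bounded_mfunM; [exact: bounded_mfun_horner|exact: bounded_mfun_hornerV].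
rewrite Lpnorm2E// lee_fin.
have := l2normM_le (bounded_weighted q) sh; rewrite Nq mul1r; congr (l2norm _ <= _).
apply/funext => t; rewrite /on_param /linearized_error /weighted.
by field; rewrite q0 w_neq0.
Qed.

End LinearizedError.

Theorem theorem7 (R : realType) (n : nat) (f : R[i] -> R[i]) (w : {poly R[i]}) :
  (1 <= n)%N -> H2bar0 f -> poly_le n w -> no_zero_on_circle w ->
  d2 f (ratfun n.-1 n) = d2 f (H2n n) /\
  exists m : \bar R,
    is_min [set Lpnorm 2%:E (fun z => (q.[z] * f z - p.[z]) / w.[z])
           | q in normalized_polys n w & p in poly_le n.-1] m
    /\ (m <= d2 f (H2n n))%E.
Proof.
move=> n1 Hf _ w1; split; first exact: d2_ratfun_H2n.
have sf : csqint (on_param f) by have [/L2P] := Hf.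
have [q [p [size_q sp Nq qmin]]] := @linearized_min R f w sf w1 n.+1 n.-1.+1 (ltn0Sn _).
exists (l2norm (on_param (linearized_error f w q p)))%:E; split; first split.
- exists q; last first.
    by exists p => //; rewrite -Lpnorm2E//; exact: csqint_linearized_error.
  split=> //; rewrite -[RHS]/(1%:E) -Nq.
  by rewrite -Lpnorm_yK//; exact: bounded_weighted.
- move=> _ [q' [size_q' Nq'] [p' sp' <-]].
  rewrite (@Lpnorm2E _ (linearized_error f w q' p')); last exact: csqint_linearized_error.
  by rewrite lee_fin; apply: qmin => //; rewrite /supnorm Nq'.
rewrite -d2_ratfun_H2n//; apply: le_ereal_inf_tmp => _ [_ [p' [q' [sp' size_q' q1 ->]]] <-].
have q0 : q' != 0.
  apply: contraTneq (q1 1 _) => [->|]; first by rewrite root0.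
  exact: normc1.
(* rescaling leaves [p' / q'] unchanged and normalizes [q' / w] *)
have c0 := supnorm_weighted_gt0 w1 q0; set c := supnorm _ in c0.
have cC0 : (c^-1)%:C != 0 :> R[i] by rewrite eq_complex /= eqxx andbT invr_eq0 gt_eqF.
have qs1 : no_zero_on_circle ((c^-1)%:C *: q') by move=> z /q1; rewrite rootZ.
have Nc : supnorm (weighted w ((c^-1)%:C *: q')) = 1.
  rewrite supnorm_weightedZ// -/c /= expr0n /= addr0 sqrtr_sqr.
  by rewrite ger0_norm ?invr_ge0 ?supnorm_ge0// mulVf// gt_eqF.
have sq2 : (size ((c^-1)%:C *: q') <= n.+1)%N by exact: leq_trans (size_scale_leq _ _) size_q'.
have sp2 : (size ((c^-1)%:C *: p') <= n.-1.+1)%N by exact: leq_trans (size_scale_leq _ _) sp'.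
apply: (@le_trans _ _ (l2norm (on_param
    (linearized_error f w ((c^-1)%:C *: q') ((c^-1)%:C *: p'))))%:E).
  by rewrite lee_fin; exact: qmin.
apply: le_trans (linearized_le_error sf w1 _ qs1 Nc) _.
rewrite le_eqVlt; apply/orP; left; apply/eqP; apply: Lpnorm_ext => t; congr (normc (_ - _)).
by rewrite !hornerZ invfM mulrACA divff// mul1r.
Qed.
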